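(* Let $\mathcal{A}$ be a unital $C^*$-algebra. Let $\{g_n\}_{n\in\mathbb{N}}$ be a Bessel sequence in $H_{\mathcal{A}}$ such that there exists a sequence $\{M_n\}_{n\in\mathbb{N}}$ of positive numbers with $\lim_{n\to\infty}M_n=0$ and $$\sum_{j=n}^\infty\langle x,g_j\rangle\langle g_j,x\rangle\le M_n\langle x,x\rangle\quad\text{for all }x\in H_{\mathcal{A}}\text{ and }n\in\mathbb{N}.$$ Then the following statements hold. (1) If $\{f_n\}_{n\in\mathbb{N}}$ is a pseudo-Riesz sequence in $H_{\mathcal{A}}$, then $\{f_n+g_n\}_{n\in\mathbb{N}}$ is a pseudo-Riesz sequence in $H_{\mathcal{A}}$. (2) If $\{f_n\}_{n\in\mathbb{N}}$ is a pseudo-Riesz basis in $H_{\mathcal{A}}$, then $\{f_n+g_n\}_{n\in\mathbb{N}}$ is a pseudo-Riesz basis in $H_{\mathcal{A}}$. (3) If $\{f_n\}_{n\in\mathbb{N}}$ is a pseudo-Riesz-Weyl sequence in $H_{\mathcal{A}}$, then $\{f_n+g_n\}_{n\in\mathbb{N}}$ is a pseudo-Riesz-Weyl sequence in $H_{\mathcal{A}}$. (4) If $\{f_n\}_{n\in\mathbb{N}}$ is a pseudo-Riesz-Weyl basis in $H_{\mathcal{A}}$, then $\{f_n+g_n\}_{n\in\mathbb{N}}$ is a pseudo-Riesz-Weyl basis in $H_{\mathcal{A}}$.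
   Context: $\mathcal{A}$ is a unital $C^*$-algebra and $H_{\mathcal{A}}$ is the standard Hilbert $\mathcal{A}$-module: sequences $(a_i)_{i\ge 1}$ in $\mathcal{A}$ with $\sum_i a_ia_i^*$ norm-convergent, left $\mathcal{A}$-action, inner product $\langle a,b\rangle=\sum_i a_ib_i^*$, and standard orthonormal basis $\{e_i\}_{i\in\mathbb{N}}$, where $\mathbb{N}=\{1,2,\dots\}$. $L_n\cong\mathcal{A}^n$ is the submodule of sequences $(x_i)$ with $x_i=0$ for $i>n$. $(\cdot)^\perp$ is the orthogonal complement in $H_{\mathcal{A}}$. An isomorphism ($\cong$) of Hilbert modules is a bounded $\mathcal{A}$-linear bijection with bounded inverse. $N\preceq N'$ means that $N$ is isomorphic to a closed submodule of $N'$. Finitely generated means algebraically finitely generated over $\mathcal{A}$. Bessel sequence: a sequence $\{f_n\}$ in a Hilbert $\mathcal{A}$-module $\mathcal X$ such that for some constant $C>0$, $\sum_n\langle x,f_n\rangle\langle f_n,x\rangle\le C\langle x,x\rangle$ for all $x\in\mathcal X$, the sum converging in norm. All such sums are understood to converge in norm. Modular Riesz basis: a sequence $\{y_i\}_{i\ge1}$ in a countably generated Hilbert $\mathcal{A}$-module $\mathcal X$ is a modular Riesz basis for $\mathcal X$ if the $\mathcal{A}$-linear operator from $H_{\mathcal{A}}$ onto $\mathcal X$ mapping $e_i$ to $y_i$ for every $i$ is invertible and adjointable. A tail $\{f_n\}_{n=k+1}^\infty$ is regarded as the sequence $y_i=f_{k+i}$. For a sequence $\{f_n\}_{n\in\mathbb{N}}\subseteq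 H_{\mathcal{A}}$ and $k\in\mathbb{N}$ write $S_k=\overline{\operatorname{Span}_{\mathcal{A}}\{f_n\}_{n=k+1}^\infty}$. Pseudo-Riesz sequence: a Bessel sequence for which there is $k\in\mathbb{N}$ such that $\{f_n\}_{n=k+1}^\infty$ is a modular Riesz basis for $S_k$. Pseudo-Riesz basis: a Bessel sequence for which there is $k\in\mathbb{N}$ such that $\{f_n\}_{n=k+1}^\infty$ is a modular Riesz basis for $S_k$ and $S_k^\perp$ is finitely generated. Pseudo-Riesz-Weyl sequence: a Bessel sequence for which there is $k\in\mathbb{N}$ such that $\{f_n\}_{n=k+1}^\infty$ is a modular Riesz basis for $S_k$ and $L_k\preceq S_k^\perp$. Pseudo-Riesz-Weyl basis: a sequence for which there is $k\in\mathbb{N}$ such that $\{f_n\}_{n=k+1}^\infty$ is a modular Riesz basis for $S_k$ and $L_k\cong S_k^\perp$.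
   Formalization: In (4), a pseudo-Riesz-Weyl basis is required to be a Bessel sequence, in hypothesis and conclusion, as in the other three notions; without this, (4) fails, for instance over B(l^2). *)

(* Defs.v *)
From HB Require Import structures.
From mathcomp Require Import all_boot all_order all_algebra.
From mathcomp Require Export complex.
From mathcomp Require Export all_classical all_reals all_analysis.

Set Implicit Arguments.
Unset Strict Implicit.
Unset Printing Implicit Defensive.

Import Order.TTheory GRing.Theory Num.Theory.
Import numFieldNormedType.Exports.

Local Open Scope classical_set_scope.
Local Open Scope ring_scope.

(** The scalar field is [R[i]] for [R : realType]; the norm of a
    [completeNormedModType R[i]] takes its values in the nonnegative reals
    inside [R[i]]. *)

(* The multiplication is a field of the mixin because the algebraic and the
   normed hierarchies have no common substructure below numDomainType that a
   joint structure could extend; the ring and algebra instances follow. *)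
HB.mixin Record isCStarAlgebra (R : realType) A
    of CompleteNormedModule R[i] A := {
  cstar_mul : A -> A -> A ;
  cstar_one : A ;
  star : A -> A ;
  cstar_mulA : associative cstar_mul ;
  cstar_mul1l : left_id cstar_one cstar_mul ;
  cstar_mulr1 : right_id cstar_one cstar_mul ;
  cstar_mulDl : left_distributive cstar_mul +%R ;
  cstar_mulDr : right_distributive cstar_mul +%R ;
  cstar_one_neq0 : cstar_one != 0 ;
  cstar_scaleAl : forall (l : R[i]) (a b : A),
    l *: cstar_mul a b = cstar_mul (l *: a) b ;
  cstar_scaleAr : forall (l : R[i]) (a b : A),
    l *: cstar_mul a b = cstar_mul a (l *: b) ;
  starD : forall a b : A, star (a + b) = star a + star b ;
  starZ : forall (l : R[i]) (a : A), star (l *: a) = (l^*)%C *: star a ;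
  starM : forall a b : A, star (cstar_mul a b) = cstar_mul (star b) (star a) ;
  starK : forall a : A, star (star a) = a ;
  cstar_normM : forall a b : A, `|cstar_mul a b| <= `|a| * `|b| ;
  cstar_norm_starM : forall a : A, `|cstar_mul (star a) a| = `|a| ^+ 2
}.

#[short(type="cstarAlgType")]
HB.structure Definition CStarAlgebra (R : realType) :=
  { A of CompleteNormedModule R[i] A & isCStarAlgebra R A }.

#[non_forgetful_inheritance]
HB.instance Definition _ (R : realType) (A : cstarAlgType R) :=
  GRing.Zmodule_isNzRing.Build (CStarAlgebra.sort A)
    (@cstar_mulA R A) (@cstar_mul1l R A) (@cstar_mulr1 R A)
    (@cstar_mulDl R A) (@cstar_mulDr R A) (@cstar_one_neq0 R A).

#[non_forgetful_inheritance]
HB.instance Definition _ (R : realType) (A : cstarAlgType R) :=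
  GRing.Lmodule_isLalgebra.Build R[i] (CStarAlgebra.sort A)
    (@cstar_scaleAl R A).

#[non_forgetful_inheritance]
HB.instance Definition _ (R : realType) (A : cstarAlgType R) :=
  GRing.Lalgebra_isAlgebra.Build R[i] (CStarAlgebra.sort A)
    (@cstar_scaleAr R A).

Definition cstar_le (R : realType) (A : cstarAlgType R) (a b : A) : Prop :=
  exists c : A, b - a = star c * c.

(** All Hilbert modules considered are submodules of H_A, represented as sets
    of sequences [nat -> A] with pointwise operations.  Sequences are indexed
    from 0: the i-th term of a sequence indexed by {1, 2, ...} is its value at
    [i - 1], so that "i > n" becomes [n <= i] and the tail starting after the
    k-th term is [fun i => f (k + i)]. *)

Definition lact (R : realType) (A : cstarAlgType R) (a : A) (x : nat -> A) :
  nat -> A := fun i => a * x i.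

Definition HA (R : realType) (A : cstarAlgType R) : set (nat -> A) :=
  [set x | cvgn (series (fun i => x i * star (x i)))].
Arguments HA {R} A _ : simpl never.

Definition hinner (R : realType) (A : cstarAlgType R) (x y : nat -> A) : A :=
  limn (series (fun i => x i * star (y i))).

Definition hnorm (R : realType) (A : cstarAlgType R) (x : nat -> A) : R :=
  Num.sqrt (complex.Re `|hinner x x|).

Definition ebasis (R : realType) (A : cstarAlgType R) (n : nat) : nat -> A :=
  fun i => (i == n)%:R.

Definition Lsub (R : realType) (A : cstarAlgType R) (n : nat) :
  set (nat -> A) :=
  [set x | HA A x /\ forall i, (n <= i)%N -> x i = 0].
Arguments Lsub {R} A n _ : simpl never.

Definition orth (R : realType) (A : cstarAlgType R) (X : set (nat -> A)) :
  set (nat -> A) :=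
  [set x | HA A x /\ forall y, X y -> hinner x y = 0].

Definition hclosure (R : realType) (A : cstarAlgType R) (X : set (nat -> A)) :
  set (nat -> A) :=
  [set x | HA A x /\
     forall eps : R, 0 < eps -> exists2 y, X y & hnorm (x - y) < eps].

Definition closed_submodule (R : realType) (A : cstarAlgType R)
    (X : set (nat -> A)) : Prop :=
  [/\ X `<=` HA A,
      X 0,
      forall (a : A) x y, X x -> X y -> X (lact a x + y) &
      hclosure X `<=` X].

Definition Aspan (R : realType) (A : cstarAlgType R) (f : nat -> nat -> A) :
  set (nat -> A) :=
  [set x | exists m (c : 'I_m -> A), x = \sum_(j < m) lact (c j) (f j)].

Definition fin_gen (R : realType) (A : cstarAlgType R) (X : set (nat -> A)) :
  Prop :=
  exists m (u : 'I_m -> nat -> A),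
    X = [set x | exists c : 'I_m -> A, x = \sum_(j < m) lact (c j) (u j)].

(** Maps between submodules are total functions on sequences; only the values
    of [T] on [X] are constrained. *)

Definition bounded_Amap (R : realType) (A : cstarAlgType R)
    (X Y : set (nat -> A)) (T : (nat -> A) -> (nat -> A)) : Prop :=
  [/\ forall x, X x -> Y (T x),
      forall (a : A) x y, X x -> X y -> T (lact a x + y) = lact a (T x) + T y &
      exists C : R, forall x, X x -> hnorm (T x) <= C * hnorm x].

Definition iso_map (R : realType) (A : cstarAlgType R)
    (X Y : set (nat -> A)) (T : (nat -> A) -> (nat -> A)) : Prop :=
  bounded_Amap X Y T /\
  exists T' : (nat -> A) -> (nat -> A),
    [/\ bounded_Amap Y X T',
        forall x, X x -> T' (T x) = x &
        forall y, Y y -> T (T' y) = y].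

Definition hiso (R : realType) (A : cstarAlgType R) (X Y : set (nat -> A)) :
  Prop := exists T, iso_map X Y T.

Definition hpreceq (R : realType) (A : cstarAlgType R) (X Y : set (nat -> A)) :
  Prop := exists Z, [/\ closed_submodule Z, Z `<=` Y & hiso X Z].

Definition adjointable (R : realType) (A : cstarAlgType R)
    (X Y : set (nat -> A)) (T : (nat -> A) -> (nat -> A)) : Prop :=
  exists Ts : (nat -> A) -> (nat -> A),
    (forall y, Y y -> X (Ts y)) /\
    (forall x y, X x -> Y y -> hinner (T x) y = hinner x (Ts y)).

Definition bessel_bound (R : realType) (A : cstarAlgType R) (C : R)
    (f : nat -> nat -> A) : Prop :=
  forall x, HA A x ->
    let s := series (fun n => hinner x (f n) * hinner (f n) x) in
    cvgn s /\ cstar_le (limn s) (C%:C%C *: hinner x x).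

Definition bessel (R : realType) (A : cstarAlgType R) (f : nat -> nat -> A) :
  Prop :=
  (forall n, HA A (f n)) /\ exists2 C : R, 0 < C & bessel_bound C f.

Definition modular_riesz_basis (R : realType) (A : cstarAlgType R)
    (X : set (nat -> A)) (y : nat -> nat -> A) : Prop :=
  exists T, [/\ iso_map (HA A) X T,
                adjointable (HA A) X T &
                forall i, T (ebasis A i) = y i].

Definition seq_tail (T : Type) (k : nat) (f : nat -> T) : nat -> T :=
  fun i => f (k + i)%N.

Definition Stail (R : realType) (A : cstarAlgType R) (f : nat -> nat -> A)
    (k : nat) : set (nat -> A) :=
  hclosure (Aspan (seq_tail k f)).

Definition pseudo_riesz_seq (R : realType) (A : cstarAlgType R)
    (f : nat -> nat -> A) : Prop :=
  bessel f /\
  exists2 k, (0 < k)%N & modular_riesz_basis (Stail f k) (seq_tail k f).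

Definition pseudo_riesz_basis (R : realType) (A : cstarAlgType R)
    (f : nat -> nat -> A) : Prop :=
  bessel f /\
  exists2 k, (0 < k)%N &
    modular_riesz_basis (Stail f k) (seq_tail k f) /\
    fin_gen (orth (Stail f k)).

Definition pseudo_riesz_weyl_seq (R : realType) (A : cstarAlgType R)
    (f : nat -> nat -> A) : Prop :=
  bessel f /\
  exists2 k, (0 < k)%N &
    modular_riesz_basis (Stail f k) (seq_tail k f) /\
    hpreceq (Lsub A k) (orth (Stail f k)).

(** As for the three preceding notions, the sequence is required to be Bessel.
    This does not follow from the Riesz condition, which only provides an
    adjoint defined on [Stail f k]: that submodule may fail to be orthogonally
    complemented in H_A, and the notion without the Bessel condition is not
    stable under small Bessel perturbations (for instance over B(l^2)). *)
Definition pseudo_riesz_weyl_basis (R : realType) (A : cstarAlgType R)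
    (f : nat -> nat -> A) : Prop :=
  bessel f /\
  exists2 k, (0 < k)%N &
    modular_riesz_basis (Stail f k) (seq_tail k f) /\
    hiso (Lsub A k) (orth (Stail f k)).

(* Main.v *)
From Stdlib Require Ncring Ncring_tac.
Require Import Defs.
From mathcomp Require Import all_boot all_order all_algebra.
From mathcomp Require Import complex all_classical all_reals all_analysis.
From mathcomp Require Import ring lra.
Import Order.TTheory GRing.Theory Num.Theory.
Import numFieldNormedType.Exports.
Local Open Scope classical_set_scope.
Local Open Scope ring_scope.

Set Implicit Arguments.
Unset Strict Implicit.
Unset Printing Implicit Defensive.

(** Let C_f : x |-> (<x, f_n>)_n be the analysis operator of a Bessel sequence
    f.  It is the adjoint of every bounded A-linear T : H_A -> H_A with
    T e_n = f_n ([adjoint]); hence the orthogonal complement of the closed span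
    of f is ker C_f ([orth_span]), and f is a modular Riesz basis of that span
    as soon as T is bounded below ([riesz_of_below]).  The whole statement thus
    becomes one about bounded operators on the single complete module H_A.

    Suppose that the tail f_{k+1}, f_{k+2}, ... is a Riesz basis, with synthesis
    operator T.  Then T^* T is invertible, so that T^* has the right inverse
    S = T (T^* T)^-1 ([right_inverse]).  Put n = k + d.  The tail of f after n has
    synthesis operator T sigma^d, where sigma is the isometric right shift, and
    its analysis operator has the right inverse S sigma^d: the lower bound of
    the former and the norm of the latter do not depend on d.  The tail of g
    after n has a synthesis operator G_n with norm at most sqrt M_n, which tends
    to 0.  For n large two things follow ([perturbation]):
    - T sigma^d + G_n, the synthesis operator of the tail of f + g, is bounded
      below, and so this tail is a Riesz basis;
    - W = 1 + S sigma^d C_{g,n} is invertible, by a Neumann series, and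
      C_{f,n} W = C_{f,n} + C_{g,n} = C_{f+g,n}, so that W maps the complement
      for f + g isomorphically onto the complement for f.
    Finally, ker C_{f,n} is the direct sum of ker C_{f,k} and S(L_d), because
    C_{f,k} S = 1; so the properties of being finitely generated, of containing
    a copy of L_k and of being isomorphic to L_k, when they hold at k, pass to n,
    with L_n in place of L_k ([fin_gen_shift], [hiso_shift]).

    The order on A enters through the Cauchy-Schwarz inequality, through the
    Bessel bounds, and through the inequality <x, x> <= C^2 <T x, T x> that a
    lower bound on T implies ([paschke]).  All of this rests on the fact that the
    elements c^* c form a closed convex cone.  The proof given here avoids the
    functional calculus: square roots are limits of an explicit iteration
    ([sqrt_1sub]), a self-adjoint a is the square of a self-adjoint element if
    and only if |t - a| <= t for t = |a| ([posA_bound], [bound_posA]), and c^* c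
    is such a square ([posA_starM]). *)

(** * Normalisation in non-commutative rings *)

Section NC.
Variable V : pzRingType.
#[local] Instance nc_ops : @Ncring.Ring_ops V 0 1 +%R *%R (fun x y => x - y) -%R eq.
Defined.
#[local] Instance nc_ring : Ncring.Ring (Ro:=nc_ops).
Proof.
constructor; try exact _.
- exact: add0r.
- exact: addrC.
- exact: addrA.
- exact: mul1r.
- exact: mulr1.
- exact: mulrA.
- exact: mulrDl.
- by move=> x y z; exact: mulrDr.
- by [].
- exact: subrr.
Qed.
End NC.
#[local] Existing Instance nc_ops.
#[local] Existing Instance nc_ring.
Ltac ncring := Ncring_tac.non_commutative_ring.
(* For identities between sequences nat -> A, proved pointwise. *)
Ltac seqring := apply/funext => ?; rewrite ?fctE; ncring.

(** * The real-valued norm of a C*-algebra and its convergent sequences *)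

Section Norm.
Context (R : realType) (A : cstarAlgType R).
Implicit Types (a b c x y z : A) (r s t : R).

(** The norm of A takes values in the real elements of R[i]; this is the same
    number as an element of R, where the order is total. *)
Definition normR a : R := complex.Re `|a|.

Lemma normRE a : `|a| = (normR a)%:C%C :> R[i].
Proof. by rewrite /normR RRe_real// normr_real. Qed.

Lemma normR_ge0 a : 0 <= normR a.
Proof. by have := normr_ge0 a; rewrite normRE -[0]/(0%:C%C) lecR. Qed.

Lemma normRD a b : normR (a + b) <= normR a + normR b.
Proof. by rewrite -lecR rmorphD /= -!normRE ler_normD. Qed.

Lemma normRN a : normR (- a) = normR a.
Proof. by rewrite /normR normrN. Qed.

Lemma normR_distC a b : normR (a - b) = normR (b - a).
Proof. by rewrite -normRN opprB. Qed.

Lemma normR0 : normR 0 = 0.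
Proof. by rewrite /normR normr0. Qed.

Lemma normR_eq0 a : normR a = 0 -> a = 0.
Proof. by move=> a0; apply/eqP; rewrite -normr_eq0 normRE a0. Qed.

Lemma normRM a b : normR (a * b) <= normR a * normR b.
Proof. rewrite -lecR rmorphM /= -!normRE; exact: cstar_normM. Qed.

Lemma normRZ r a : normR (r%:C%C *: a) = `|r| * normR a.
Proof.
by apply: complexI; rewrite rmorphM /= -!normRE normrZ normc_def /= expr0n addr0 sqrtr_sqr.
Qed.


Lemma normR_starM a : normR (star a * a) = normR a ^+ 2.
Proof.
apply: complexI. rewrite rmorphXn /= -!normRE; exact: cstar_norm_starM.
Qed.


Lemma star0 : star (0 : A) = 0.
Proof. by apply: (addrI (star 0)); rewrite -starD !addr0. Qed.

Lemma starN a : star (- a) = - star a.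
Proof. by apply: (addrI (star a)); rewrite -starD !subrr star0. Qed.

Lemma starB a b : star (a - b) = star a - star b.
Proof. by rewrite starD starN. Qed.

Lemma starMm a b : star (a * b) = star b * star a.
Proof. exact: starM. Qed.

Lemma star1 : star (1 : A) = 1.
Proof. by rewrite -[RHS]starK -{2}[star 1]mulr1 starMm starK mulr1. Qed.

Lemma starZr r a : star (r%:C%C *: a) = r%:C%C *: star a.
Proof. by rewrite starZ conjc_real. Qed.

Lemma starZi a : star ('i%C *: a) = - ('i%C *: star a).
Proof. by rewrite starZ -scaleNr; congr (_ *: _); simpc. Qed.

Lemma star_sum (I : Type) (s : seq I) (P : pred I) (F : I -> A) :
  star (\sum_(i <- s | P i) F i) = \sum_(i <- s | P i) star (F i).
Proof. exact: (big_morph _ starD star0). Qed.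

(** The C*-identity gives |b|^2 = |b^* b| <= |b^*| |b|. *)
Lemma normR_star a : normR (star a) = normR a.
Proof.
suff H b : normR b <= normR (star b).
  by apply/eqP; rewrite eq_le H -{2}[a]starK H.
have [->|b0] := eqVneq b 0; first by rewrite star0.
have b_gt0 : 0 < normR b.
  by rewrite lt_neqAle normR_ge0 andbT eq_sym; apply: contra b0 => /eqP/normR_eq0->.
by have := normRM (star b) b; rewrite normR_starM expr2 ler_pM2r.
Qed.

Lemma normR_Mstar a : normR (a * star a) = normR a ^+ 2.
Proof. by rewrite -{1}[a]starK normR_starM normR_star. Qed.

Lemma normR1 : normR (1 : A) = 1.
Proof.
have n1 : normR (1 : A) != 0.
  by apply/eqP => /normR_eq0 /eqP; rewrite oner_eq0.
apply: (mulfI n1); rewrite mulr1 -expr2 -normR_starM star1 mulr1 //.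
Qed.

Lemma normR_real r : normR (r%:C%C *: (1 : A)) = `|r|.
Proof. by rewrite normRZ normR1 mulr1. Qed.

Lemma normR_sqr_sa a : star a = a -> normR (a * a) = normR a ^+ 2.
Proof. by move=> selfadj; rewrite -{1}selfadj normR_starM. Qed.

Lemma scaler_real_nat n a : n%:R *: a = (n%:R : R)%:C%C *: a :> A.
Proof. by rewrite rmorph_nat. Qed.

Definition cvgA (u : nat -> A) l := forall e : R, 0 < e ->
  exists N, forall n, (N <= n)%N -> normR (u n - l) < e.

Lemma cvgAP (u : nat -> A) l : u @ \oo --> l <-> cvgA u l.
Proof.
split.
  move=> /cvgrPdist_lt ul e e0.
  have := ul e%:C%C; rewrite -[0]/(0%:C%C) ltcR => /(_ e0) [N _ H].
  exists N => n Nn; have := H n Nn; rewrite normRE ltcR normR_distC //.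
move=> ul; apply/cvgrPdist_lt => e e0.
have eR : e = (complex.Re e)%:C%C by rewrite RRe_real// gtr0_real.
have := e0; rewrite eR -[0]/(0%:C%C) ltcR => /ul [N H].
by exists N => // n /= Nn; rewrite normRE ltcR normR_distC H.
Qed.

Lemma cvgA_unique (u : nat -> A) l m : cvgA u l -> cvgA u m -> l = m.
Proof.
by move=> /cvgAP ul /cvgAP um; apply: (cvg_unique _ ul um); exact: norm_hausdorff.
Qed.

Lemma cvgA_lim (u : nat -> A) l : cvgA u l -> limn u = l.
Proof. by move=> /cvgAP ul; apply: cvg_lim ul; exact: norm_hausdorff. Qed.

Lemma cauchyA (u : nat -> A) :
  (forall e : R, 0 < e -> exists N, forall m n, (N <= m)%N -> (m <= n)%N ->
     normR (u n - u m) < e) -> cvgA u (limn u).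
Proof.
move=> uC; apply/cvgAP; apply: cauchy_cvg; apply/cauchy_exP => e e0.
have eR : e = (complex.Re e)%:C%C by rewrite RRe_real// gtr0_real.
have := e0; rewrite eR -[0]/(0%:C%C) ltcR => /uC [N H].
exists (u N); exists N => // n /= Nn.
by rewrite -ball_normE /= distrC normRE ltcR; exact: H.
Qed.

End Norm.


Section Limits.
Context (R : realType) (A : cstarAlgType R).
Implicit Types (a b c x y z : A) (r s t : R) (u v : nat -> A).

Lemma cvgA_cst a : cvgA (fun=> a) a.
Proof. by move=> e e0; exists 0%N => n _; rewrite subrr normR0. Qed.

Lemma cvgAD u v a b : cvgA u a -> cvgA v b -> cvgA (fun n => u n + v n) (a + b).
Proof. by move=> /cvgAP ua /cvgAP vb; apply/cvgAP; apply: cvgD. Qed.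

Lemma cvgAN u a : cvgA u a -> cvgA (fun n => - u n) (- a).
Proof. by move=> /cvgAP ua; apply/cvgAP; apply: cvgN. Qed.

Lemma cvgAB u v a b : cvgA u a -> cvgA v b -> cvgA (fun n => u n - v n) (a - b).
Proof. by move=> ua vb; apply: cvgAD => //; apply: cvgAN. Qed.

Lemma cvgA_star u a : cvgA u a -> cvgA (fun n => star (u n)) (star a).
Proof.
by move=> ua e /ua[N H]; exists N => n /H; rewrite -starB normR_star.
Qed.

Lemma cvgAM u v a b : cvgA u a -> cvgA v b -> cvgA (fun n => u n * v n) (a * b).
Proof.
move=> ua vb e e0; pose C := 1 + normR a + normR b.
have C0 : 0 < C by rewrite /C; have := normR_ge0 a; have := normR_ge0 b; lra.
have d0 : 0 < Num.min 1 (e / C) by rewrite lt_min ltr01 divr_gt0.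
have [N HN] := ua _ d0; have [N' HN'] := vb _ d0.
exists (maxn N N') => n; rewrite geq_max => /andP[/HN H /HN' H'].
set p := u n - a in H; set q := v n - b in H'.
have -> : u n * v n - a * b = p * q + p * b + a * q.
  by rewrite /p /q; ncring.
move: H H'; rewrite !lt_min ltr_pdivlMr// ltr_pdivlMr// => /andP[p1 pC] /andP[q1 qC].
have := normRD (p * q + p * b) (a * q); have := normRD (p * q) (p * b).
have := normRM p q; have := normRM p b; have := normRM a q; rewrite /C in pC qC.
have := normR_ge0 a; have := normR_ge0 b; have := normR_ge0 p; have := normR_ge0 q.
nra.
Qed.


Lemma cvgAZ r u a : cvgA u a -> cvgA (fun n => r%:C%C *: u n) (r%:C%C *: a).
Proof. by move=> /cvgAP ua; apply/cvgAP; apply: cvgZr. Qed.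

Lemma cvgAS u a : cvgA u a -> cvgA (fun n => u n.+1) a.
Proof. by move=> ua e /ua[N H]; exists N => n Nn; apply: H; exact: leqW. Qed.

Lemma cvgA_normR_le u a r : cvgA u a -> (exists N, forall n, (N <= n)%N -> normR (u n) <= r) ->
  normR a <= r.
Proof.
move=> ua [N H]; apply/ler_addgt0Pr => e e0; have [N' H'] := ua _ e0.
have := H _ (leq_maxl N N'); have := H' _ (leq_maxr N N').
set v := u _; have := normRD v (- (v - a)); rewrite normRN opprB addrC subrK.
lra.
Qed.

End Limits.

(** * Square roots *)

Section Sqrt.
Context (R : realType) (A : cstarAlgType R).
Implicit Types (a b c x y z : A) (r s t : R).

Definition selfadj a := star a = a.

(** If y = (x + y^2) / 2 then (1 - y)^2 = 1 - x.  The iterates of this fixed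
    point equation are polynomials in x with nonnegative coefficients, hence are
    dominated in norm by the scalar iterates [sqrt_bnd] for x = 1. *)
Fixpoint sqrt_seq x n : A :=
  if n is m.+1 then 2^-1%:C%C *: (x + sqrt_seq x m * sqrt_seq x m) else 0.

Fixpoint sqrt_bnd n : R :=
  if n is m.+1 then 2^-1 * (1 + sqrt_bnd m * sqrt_bnd m) else 0.

Lemma sqrt_bnd01 n : 0 <= sqrt_bnd n <= 1.
Proof.
elim: n => [|n /andP[]]; first by rewrite /= lexx ler01.
by rewrite /=; set t := sqrt_bnd n => t0 t1; apply/andP; split; nra.
Qed.

Lemma sqrt_bndS n : sqrt_bnd n <= sqrt_bnd n.+1.
Proof. by rewrite /=; set t := sqrt_bnd n; have := sqr_ge0 (1 - t); nra. Qed.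

Lemma sqrt_bnd_mono m n : (m <= n)%N -> sqrt_bnd m <= sqrt_bnd n.
Proof. exact: (homo_leq (@lexx _ _) le_trans sqrt_bndS). Qed.

Lemma sqrt_bnd_cauchy e : 0 < e ->
  exists N, forall m n, (N <= m)%N -> (m <= n)%N -> sqrt_bnd n - sqrt_bnd m < e.
Proof.
move=> e0; have nd : {homo sqrt_bnd : m n / (m <= n)%N >-> m <= n}.
  exact: sqrt_bnd_mono.
have ub : has_ubound (range sqrt_bnd).
  by exists 1 => _ [n _ <-]; case/andP: (sqrt_bnd01 n).
have cv := nondecreasing_is_cvgn nd ub.
have := cv; move=> /cvgrPdist_lt /(_ e e0) [N _ H].
exists N => m n Nm mn; have /= := H m Nm.
have := nondecreasing_cvgn_le nd cv n; have := nondecreasing_cvgn_le nd cv m.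
by move=> h1 h2; rewrite ger0_norm ?subr_ge0//; lra.
Qed.

Lemma sqrt_seq_bnd x n : normR x <= 1 -> normR (sqrt_seq x n) <= sqrt_bnd n.
Proof.
move=> x1; elim: n => [|n IH] /=; first by rewrite normR0.
rewrite normRZ ger0_norm ?invr_ge0 ?ler0n//.
have := normRD x (sqrt_seq x n * sqrt_seq x n).
have := normRM (sqrt_seq x n) (sqrt_seq x n); move: IH.
have := normR_ge0 (sqrt_seq x n); have /andP[] := sqrt_bnd01 n.
set t := sqrt_bnd n; set p := normR (sqrt_seq x n); nra.
Qed.

Lemma sqrt_seq_step x n : normR x <= 1 ->
  normR (sqrt_seq x n.+1 - sqrt_seq x n) <= sqrt_bnd n.+1 - sqrt_bnd n.
Proof.
move=> x1; elim: n => [|n IH].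
  rewrite /= !mulr0 !addr0 !subr0 normRZ ger0_norm ?invr_ge0 ?ler0n//; lra.
have sS k : sqrt_seq x k.+1 = 2^-1%:C%C *: (x + sqrt_seq x k * sqrt_seq x k) by [].
have tS k : sqrt_bnd k.+1 = 2^-1 * (1 + sqrt_bnd k * sqrt_bnd k) by [].
rewrite [sqrt_seq x n.+2]sS [in X in _ - X]sS [sqrt_bnd n.+2]tS [in X in _ <= _ - X]tS.
rewrite -scalerBr normRZ ger0_norm ?invr_ge0 ?ler0n// -mulrBr ler_pM2l ?invr_gt0 ?ltr0n//.
have := sqrt_seq_bnd n x1; have := sqrt_seq_bnd n.+1 x1; move: IH.
set y := sqrt_seq x n; set y' := sqrt_seq x n.+1.
set t := sqrt_bnd n; set t' := sqrt_bnd n.+1 => IH h1 h2.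
have -> : x + y' * y' - (x + y * y) = (y' - y) * y' + y * (y' - y) by ncring.
have := normRD ((y' - y) * y') (y * (y' - y)).
have := normRM (y' - y) y'; have := normRM y (y' - y).
have := normR_ge0 y; have := normR_ge0 y'; have := normR_ge0 (y' - y).
nra.
Qed.

Lemma sqrt_seq_dist x m n : normR x <= 1 -> (m <= n)%N ->
  normR (sqrt_seq x n - sqrt_seq x m) <= sqrt_bnd n - sqrt_bnd m.
Proof.
move=> x1 /subnK<-; elim: (n - m)%N => [|k IH].
  by rewrite add0n !subrr normR0.
rewrite addSn; have := sqrt_seq_step (k + m) x1; move: IH.
set y := sqrt_seq x (k + m); set y' := sqrt_seq x (k + m).+1.
have := normRD (y' - y) (y - sqrt_seq x m); rewrite addrA subrK; lra.
Qed.

(** As a limit of polynomials in x, the root commutes with everything that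
    commutes with x. *)
Lemma sqrt_1sub x : selfadj x -> normR x <= 1 -> exists y,
  [/\ selfadj y, normR y <= 1, (1 - y) * (1 - y) = 1 - x &
      forall z, z * x = x * z -> z * y = y * z].
Proof.
move=> sx x1; pose y := limn (sqrt_seq x).
have cy : cvgA (sqrt_seq x) y.
  apply: cauchyA => e /sqrt_bnd_cauchy[N H]; exists N => m n Nm mn.
  exact: le_lt_trans (sqrt_seq_dist x1 mn) (H _ _ Nm mn).
have ey : y = 2^-1%:C%C *: (x + y * y).
  apply: cvgA_unique (cvgAS cy) _ => /=.
  by apply: cvgAZ; apply: cvgAD; [exact: cvgA_cst|exact: cvgAM].
exists y; split.
- apply: cvgA_unique (cvgA_star cy) _; suff -> : (fun n => star (sqrt_seq x n)) = sqrt_seq x by [].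
  apply/funext; elim=> [|n IH] /=; first by rewrite star0.
  by rewrite starZr starD starMm IH sx.
- apply: cvgA_normR_le cy _; exists 0%N => n _; apply: le_trans (sqrt_seq_bnd n x1) _.
  by case/andP: (sqrt_bnd01 n).
- have e2 : y + y = x + y * y.
    rewrite -mulr2n -scaler_nat scaler_real_nat {1}ey scalerA -rmorphM /= divff ?pnatr_eq0//.
    by rewrite rmorph1 scale1r.
  have -> : (1 - y) * (1 - y) = 1 - (y + y) + y * y by ncring.
  by rewrite e2; ncring.
- move=> z zx; apply: cvgA_unique (cvgAM (cvgA_cst z) cy) _.
  suff -> : (fun n => z * sqrt_seq x n) = (fun n => sqrt_seq x n * z).
    by apply: cvgAM => //; exact: cvgA_cst.
  apply/funext; elim=> [|n IH] /=; first by rewrite mulr0 mul0r.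
  rewrite -scalerAr -scalerAl mulrDr mulrDl zx mulrA IH -!mulrA IH //.
Qed.

End Sqrt.


(** * Positive elements *)

Section Positive.
Context (R : realType) (A : cstarAlgType R).
Implicit Types (a b c d x y z : A) (r s t e : R).

(** Scalar factors are written inside the ring, where they are central, so that
    ring normalisation can handle them as atoms. *)
Definition realA r : A := r%:C%C *: 1.

Lemma realA0 : realA 0 = 0. Proof. by rewrite /realA rmorph0 scale0r. Qed.
Lemma realA1 : realA 1 = 1. Proof. by rewrite /realA rmorph1 scale1r. Qed.
Lemma realAD r s : realA (r + s) = realA r + realA s.
Proof. by rewrite /realA rmorphD scalerDl. Qed.
Lemma realAN r : realA (- r) = - realA r.
Proof. by rewrite /realA rmorphN scaleNr. Qed.
Lemma realAB r s : realA (r - s) = realA r - realA s.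
Proof. by rewrite realAD realAN. Qed.
Lemma mul_realA_l r a : realA r * a = r%:C%C *: a.
Proof. by rewrite /realA -scalerAl mul1r. Qed.
Lemma mul_realA_r r a : a * realA r = r%:C%C *: a.
Proof. by rewrite /realA -scalerAr mulr1. Qed.
Lemma realAC r a : a * realA r = realA r * a.
Proof. by rewrite mul_realA_l mul_realA_r. Qed.
Lemma realAM r s : realA (r * s) = realA r * realA s.
Proof. by rewrite mul_realA_l /realA scalerA rmorphM. Qed.
Lemma realAMA r s a : realA r * (realA s * a) = realA (r * s) * a.
Proof. by rewrite realAM mulrA. Qed.
Lemma selfadj_realA r : selfadj (realA r).
Proof. by rewrite /selfadj /realA starZr star1. Qed.
Lemma normR_realA r : normR (realA r) = `|r|.
Proof. exact: normR_real. Qed.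
Lemma scale_realA r a : r%:C%C *: a = realA r * a.
Proof. by rewrite mul_realA_l. Qed.
Lemma normR_realAM r a : normR (realA r * a) = `|r| * normR a.
Proof. by rewrite mul_realA_l normRZ. Qed.

Lemma selfadjD a b : selfadj a -> selfadj b -> selfadj (a + b).
Proof. by rewrite /selfadj starD => -> ->. Qed.
Lemma selfadjB a b : selfadj a -> selfadj b -> selfadj (a - b).
Proof. by rewrite /selfadj starB => -> ->. Qed.
Lemma selfadjM a b : selfadj a -> selfadj b -> a * b = b * a -> selfadj (a * b).
Proof. by rewrite /selfadj starMm => -> -> ->. Qed.
Lemma selfadj_realAM r a : selfadj a -> selfadj (realA r * a).
Proof. by move=> s; apply: selfadjM => //; [exact: selfadj_realA|rewrite realAC]. Qed.
Lemma selfadj_starM a : selfadj (star a * a).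
Proof. by rewrite /selfadj starMm starK. Qed.

(** Squares of self-adjoint elements.  They turn out to be the same as the
    elements c^* c ([cstar_leP]), but this form is the one for which the
    characterisation by norms, and so the stability under sums, is within direct
    reach. *)
Definition posA a := exists2 b, selfadj b & b * b = a.

Lemma posA_selfadj a : posA a -> selfadj a.
Proof. by move=> [b sb <-]; exact: selfadjM. Qed.

Lemma sqrt_bound t a : selfadj a -> 0 <= t -> normR (realA t - a) <= t -> exists b,
  [/\ selfadj b, b * b = a, normR (realA (Num.sqrt t) - b) <= Num.sqrt t &
      forall z, z * a = a * z -> z * b = b * z].
Proof.
move=> sA; rewrite le_eqVlt => /predU1P[<-|t0] nt.
  have a0 : a = 0.
    apply: normR_eq0; apply/eqP; rewrite eq_le normR_ge0 andbT.
    by rewrite realA0 sub0r normRN in nt.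
  exists 0; rewrite sqrtr0 realA0 subrr normR0 mul0r a0; split=> //; first exact: star0.
have tn0 : t != 0 by rewrite gt_eqF.
pose x := 1 - realA t^-1 * a.
have xe : x = realA t^-1 * (realA t - a).
  by rewrite /x mulrBr -realAM mulVf// realA1.
have sx : selfadj x by apply: selfadjB; [exact: star1|exact: selfadj_realAM].
have nx : normR x <= 1.
  have t1 : 0 <= t^-1 by rewrite invr_ge0 ltW.
  by rewrite xe normR_realAM ger0_norm// ler_pdivrMl// mulr1.
have [y [sy ny ye yc]] := sqrt_1sub sx nx.
exists (realA (Num.sqrt t) * (1 - y)); split.
- by apply: selfadj_realAM; apply: selfadjB => //; exact: star1.
- rewrite mulrA -[_ * _ * realA _]mulrA realAC mulrA -realAM -expr2 sqr_sqrtr ?ltW//.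
  by rewrite -mulrA ye /x opprB addrC subrK realAMA divff// realA1 mul1r.
- rewrite mulrBr mulr1 opprB addrC subrK normR_realAM ger0_norm ?sqrtr_ge0//.
  by rewrite ler_piMr ?sqrtr_ge0.
- move=> z za; have zx : z * x = x * z.
    by rewrite /x mulrBr mulrBl mulr1 mul1r mulrA realAC -!mulrA za.
  by rewrite mulrA realAC -!mulrA mulrBr mulrBl mulr1 mul1r (yc _ zx).
Qed.

(** u = b + i c satisfies u^* u = s, and 2 b = u + u^* . *)
Lemma circle b c s : selfadj b -> selfadj c -> b * c = c * b ->
  b * b + c * c = realA s -> 0 <= s ->
  normR b ^+ 2 <= s.
Proof.
move=> sb sc bc bcs s0; pose d := 'i%C *: c; pose u := b + d.
have sd : star d = - d by rewrite starZi sc.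
have bd : b * d = d * b by rewrite /d -scalerAr -scalerAl bc.
have dd : d * d = - (c * c).
  by rewrite /d -scalerAr -scalerAl scalerA -expr2 sqr_i scaleN1r.
have uu : star u * u = realA s.
  rewrite /u starD sb sd -bcs; transitivity (b * b + b * d - d * b - d * d); first by ncring.
  by rewrite bd dd; ncring.
have nu : normR u ^+ 2 = s by rewrite -normR_starM uu normR_realA ger0_norm.
have b2 : realA 2 * b = u + star u.
  rewrite starD sb sd -[2]/(1 + 1) realAD realA1; by rewrite /u; ncring.
have := normRD u (star u); rewrite -b2 normR_realAM normR_star ger0_norm// => h.
rewrite -nu; apply: lerXn2r; rewrite ?nnegrE ?normR_ge0//; lra.
Qed.

(** Write a = b^2 and take c with c^2 = t - a: then b^2 + c^2 = t. *)
Lemma posA_bound a t : posA a -> normR a <= t -> normR (realA t - a) <= t.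
Proof.
move=> pa nt; have sA := posA_selfadj pa; case: pa => b sb ba.
have t0 : 0 <= t by apply: le_trans (normR_ge0 a) nt.
have h : normR (realA t - (realA t - a)) <= t by rewrite opprB addrC subrK.
have [c [sc cc _ com]] := sqrt_bound (selfadjB (selfadj_realA t) sA) t0 h.
rewrite -cc normR_sqr_sa//; apply: (@circle c b) => //.
  by rewrite com// mulrBr mulrBl realAC -ba mulrA.
by rewrite cc ba subrK.
Qed.

Lemma bound_posA a t : selfadj a -> 0 <= t -> normR (realA t - a) <= t -> posA a.
Proof. by move=> sA t0 /(sqrt_bound sA t0)[b [sb ba _ _]]; exists b. Qed.

Lemma posA_sqrt a : posA a -> exists b,
  [/\ posA b, b * b = a & forall z, z * a = a * z -> z * b = b * z].
Proof.
move=> pa; have [b [sb ba nb com]] :=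
  sqrt_bound (posA_selfadj pa) (normR_ge0 a) (posA_bound pa (lexx _)).
by exists b; split=> //; apply: bound_posA nb => //; exact: sqrtr_ge0.
Qed.

(** The condition |t - a| <= t is additive in the pair (t, a). *)
Lemma posAD a b : posA a -> posA b -> posA (a + b).
Proof.
move=> pa pb; apply: (@bound_posA _ (normR a + normR b)).
- by apply: selfadjD; exact: posA_selfadj.
- by rewrite addr_ge0 ?normR_ge0.
have := posA_bound pa (lexx _); have := posA_bound pb (lexx _).
have := normRD (realA (normR a) - a) (realA (normR b) - b).
have -> : realA (normR a + normR b) - (a + b) = realA (normR a) - a + (realA (normR b) - b).
  by rewrite realAD; ncring.
lra.
Qed.

Lemma posA_realA r : 0 <= r -> posA (realA r).
Proof.
by move=> r0; exists (realA (Num.sqrt r)); [exact: selfadj_realA|rewrite -realAM -expr2 sqr_sqrtr].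
Qed.

Lemma posA0 : posA 0. Proof. by rewrite -realA0; exact: posA_realA. Qed.

Lemma posA_sqr b : selfadj b -> posA (b * b). Proof. by exists b. Qed.

Lemma posAZ r a : 0 <= r -> posA a -> posA (realA r * a).
Proof.
move=> r0 [b sb ba]; exists (realA (Num.sqrt r) * b); first exact: selfadj_realAM.
rewrite mulrA -[_ * b * realA _]mulrA realAC mulrA -realAM -expr2 sqr_sqrtr//.
by rewrite -mulrA ba.
Qed.

Lemma posA_realAB t a : selfadj a -> normR a <= t -> posA (realA t - a).
Proof.
move=> sA nt; apply: (@bound_posA _ t).
- by apply: selfadjB => //; exact: selfadj_realA.
- exact: le_trans (normR_ge0 a) nt.
- by rewrite opprB addrC subrK.
Qed.

(** The roots of a and of s - a commute, so that [circle] applies. *)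
Lemma posA_normR_le a s : posA a -> posA (realA s - a) -> 0 <= s -> normR a <= s.
Proof.
move=> pa psa s0; have [b [pb ba bc]] := posA_sqrt pa.
have [c [pc cs cc]] := posA_sqrt psa.
rewrite -ba normR_sqr_sa; last exact: posA_selfadj.
apply: (@circle b c) => //; try exact: posA_selfadj.
  by apply: cc; rewrite mulrBr mulrBl realAC -ba mulrA.
by rewrite ba cs addrC subrK.
Qed.

Lemma posA_closed a : selfadj a -> (forall e, 0 < e -> posA (a + realA e)) -> posA a.
Proof.
move=> sA H; apply: (@bound_posA _ (normR a)) => //; first exact: normR_ge0.
apply/ler_addgt0Pr => e e0; have := posA_bound (H _ e0) (t := normR a + e).
have -> : realA (normR a + e) - (a + realA e) = realA (normR a) - a by rewrite realAD; ncring.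
apply; have := normRD a (realA e); rewrite normR_realA gtr0_norm//.
Qed.

Lemma posA_cvg (u : nat -> A) a : cvgA u a -> (forall n, posA (u n)) -> posA a.
Proof.
move=> ua pu; have sA : selfadj a.
  apply: cvgA_unique (cvgA_star ua) _.
  suff -> : (fun n => star (u n)) = u by [].
  by apply/funext => n; exact: posA_selfadj.
apply: posA_closed => // e e0; have [N H] := ua _ e0.
have -> : a + realA e = u N + (realA e - (u N - a)) by ncring.
apply: posAD => //; apply: posA_realAB; last by rewrite ltW ?H.
by apply: selfadjB => //; exact: posA_selfadj.
Qed.

End Positive.

(** * Geometric series, inverses and the positivity of c^* c *)

Lemma geo_small (R : realType) (C q e : R) : 0 <= q < 1 -> 0 < e ->
  exists N, forall n, (N <= n)%N -> C * q ^+ n < e.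
Proof.
move=> /andP[q0 q1] e0; have := @cvg_geometric R C q; rewrite ger0_norm// => /(_ q1).
move=> /cvgrPdist_lt /(_ e e0)[N _ H]; exists N => n Nn; have /= := H n Nn.
by rewrite sub0r normrN => /(le_lt_trans (ler_norm _)).
Qed.

(** Stated for a function d of the indices obeying the triangle inequality, as it
    serves both for sequences in A and for sequences in H_A. *)
Lemma geo_cauchy (R : realType) (d : nat -> nat -> R) (C q : R) :
  0 <= q < 1 -> 0 <= C -> (forall n, d n n <= 0) ->
  (forall m n p, d m p <= d m n + d n p) ->
  (forall n, d n n.+1 <= C * q ^+ n) -> forall e, 0 < e ->
  exists N, forall m n, (N <= m)%N -> (m <= n)%N -> d m n < e.
Proof.
move=> q01 C0 dn dt dS e e0; have /andP[q0 q1] := q01.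
have [N H] := geo_small (C / (1 - q)) q01 e0.
exists N => m n Nm /subnK<-; apply: le_lt_trans (H m Nm).
suff h : d m (n - m + m)%N <= C / (1 - q) * (q ^+ m - q ^+ (n - m + m)).
  apply: le_trans h _; rewrite ler_wpM2l ?divr_ge0 ?subr_ge0 ?(ltW q1)//.
  by rewrite gerBl exprn_ge0.
elim: (n - m)%N => [|k IH]; first by rewrite add0n subrr mulr0.
rewrite addSn exprS; apply: le_trans (dt _ (k + m)%N _) _.
apply: le_trans (lerD IH (dS _)) _; rewrite le_eqVlt; apply/orP; left; apply/eqP.
by field; rewrite subr_eq0 gt_eqF.
Qed.

Section PositiveCone.
Context (R : realType) (A : cstarAlgType R).
Implicit Types (a b c d x y z : A) (r s t e : R).

Lemma geo_inv x : normR x < 1 -> exists w, w * (1 - x) = 1 /\ (1 - x) * w = 1.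
Proof.
move=> x1; pose u n := \sum_(i < n) x ^+ i.
have xn n : normR (x ^+ n) <= normR x ^+ n.
  elim: n => [|n IH]; first by rewrite !expr0 normR1.
  by rewrite !exprS; apply: le_trans (normRM _ _) _; rewrite ler_wpM2l ?normR_ge0.
have q01 : 0 <= normR x < 1 by rewrite normR_ge0.
have cu : cvgA u (limn u).
  apply: cauchyA; apply: (@geo_cauchy _ _ 1 (normR x)) => //.
  - by move=> n; rewrite subrr normR0.
  - by move=> m n p; have := normRD (u p - u n) (u n - u m);
    rewrite addrA subrK [X in _ <= X -> _]addrC.
  - by move=> n; rewrite mul1r /u big_ord_recr /= addrAC subrr add0r.
have c1 : cvgA (fun n => 1 - x ^+ n) 1.
  move=> e e0; have [N H] := geo_small 1 q01 e0; exists N => n /H.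
  by rewrite mul1r addrC addKr normRN; exact: le_lt_trans.
have cx := cvgA_cst (1 - x).
exists (limn u); split.
- apply: cvgA_unique (cvgAM cu cx) _; congr (cvgA _ _): c1; apply/funext => n.
  rewrite -opprB subrX1 -mulNr opprB /u mulr_sumr mulr_suml.
  by apply: eq_bigr => i _; rewrite mulrBl mulrBr mulr1 mul1r -exprS exprSr.
- apply: cvgA_unique (cvgAM cx cu) _; congr (cvgA _ _): c1; apply/funext => n.
  by rewrite -opprB subrX1 -mulNr opprB.
Qed.


(** With r = |d|^2, the element r + d d^* is invertible, and therefore so is
    r + d^* d = r - a, where a = - d^* d is positive with |a| = r.  But an
    invertible positive r - a is at least some 1/n > 0, which gives the
    contradiction |a| <= r - 1/n. *)
Lemma neg_starM_eq0 d : posA (- (star d * d)) -> posA (d * star d) -> d = 0.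
Proof.
move=> pn pp; apply: normR_eq0; apply/eqP; apply: contraT => d0.
have dgt0 : 0 < normR d by rewrite lt_neqAle eq_sym d0 normR_ge0.
pose r := normR d ^+ 2; have r0 : 0 < r by rewrite exprn_gt0.
pose a := - (star d * d); pose p := d * star d.
have na : normR a = r by rewrite normRN normR_starM.
have np : normR p = r by rewrite /p normR_Mstar.
have [w [_ w1]] : exists w, w * (realA A r + p) = 1 /\ (realA A r + p) * w = 1.
  pose x := realA A (2 * r)^-1 * (realA A r - p).
  have r2 : 2 * r != 0 by rewrite mulf_neq0 ?pnatr_eq0 ?gt_eqF.
  have e : realA A r + p = realA A (2 * r) * (1 - x).
    rewrite mulrBr mulr1 /x realAMA divff// realA1 mul1r mulr_natl mulr2n realAD.
    by ncring.
  have x1 : normR x < 1.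
    have r2i : 0 <= (2 * r)^-1 by rewrite invr_ge0 mulr_ge0// ltW.
    rewrite normR_realAM ger0_norm// ltr_pdivrMl ?mulr_gt0// mulr1.
    have := posA_bound pp (t := r); rewrite -/p np lexx => /(_ isT); lra.
  have [w [w1 w2]] := geo_inv x1; exists (realA A (2 * r)^-1 * w); rewrite e; split.
    rewrite -realAC -mulrA realAMA mulVf// realA1 mul1r //.
  by rewrite -[_ * (1 - x)]realAC -mulrA realAMA divff// realA1 mul1r.
(* The inverse of r + d^* d in terms of the inverse w of r + d d^*. *)
pose v := realA A r^-1 * (1 - star d * w * d).
have v1 : (realA A r - a) * v = 1.
  have e : (realA A r - a) * (1 - star d * w * d) = realA A r.
    have -> : (realA A r - a) * (1 - star d * w * d) =
      realA A r + star d * d - realA A r * star d * w * d - star d * (p * w) * d.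
      by rewrite /a /p; ncring.
    have -> : p * w = 1 - realA A r * w by rewrite -w1; ncring.
    rewrite -[realA A r * star d]realAC; ncring.
  by rewrite /v mulrA realAC -mulrA e -realAM mulVf ?gt_eqF// realA1.
have sra : selfadj (realA A r - a) by apply: selfadjB; [exact: selfadj_realA|exact: posA_selfadj pn].
have vl : star v * (realA A r - a) = 1 by rewrite -[realA A r - a]sra -starMm v1 star1.
have sv : selfadj v by rewrite /selfadj -[star v]mulr1 -v1 mulrA vl mul1r.
have v2 : v * (realA A r - a) = 1 by rewrite -{1}sv.
have pra : posA (realA A r - a) by apply: posA_realAB; [exact: posA_selfadj pn|rewrite na].
have [k [pk kk kc]] := posA_sqrt pra.
pose n := normR v.
(* v <= n = |v| yields 1/n <= v^-1 = r - a, all these elements commuting. *)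
have [m [pm mm mc]] := posA_sqrt (posA_realAB sv (lexx n)).
have kv : k * v = v * k.
  have kra : k * (realA A r - a) = (realA A r - a) * k by rewrite -kk mulrA.
  rewrite -[k * v]mul1r -v2 -mulrA [_ * (k * v)]mulrA -kra -[k * _ * v]mulrA v1 mulr1 //.
have km : k * m = m * k by apply: mc; rewrite mulrBr mulrBl realAC kv.
have rn : 1 <= r * n.
  have := normRM (realA A r - a) v; rewrite v1 normR1 => /le_trans; apply.
  rewrite ler_wpM2r ?normR_ge0//; apply: (posA_bound pn (t := r)).
  by rewrite -/a na.
have n0 : 0 < n by rewrite -(pmulr_rgt0 _ r0); apply: lt_le_trans rn.
have pf : posA (realA A (r - n^-1) - a).
  have -> : realA A (r - n^-1) - a = realA A n^-1 * ((k * m) * (k * m)).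
    have -> : (k * m) * (k * m) = (k * k) * (m * m).
      by rewrite -mulrA [m * (k * m)]mulrA -km !mulrA.
    rewrite kk mm mulrBr v1 realAC mulrBr mulr1 !mulrA -realAM mulVf ?gt_eqF// realA1 mul1r realAB.
    by ncring.
  apply: posAZ; first by rewrite invr_ge0 ltW.
  by apply: posA_sqr; apply: selfadjM => //; exact: posA_selfadj.
have := posA_normR_le pn pf; rewrite -/a na subr_ge0 -[n^-1]mul1r ler_pdivrMr//.
by move=> /(_ rn); rewrite mul1r lerBrDl gerDr leNgt invr_gt0 n0.
Qed.

(** Let h = c^* c, b = |h| the root of h^2, l the root of b and m = b - h, twice
    the negative part of h.  Then d = c m satisfies - d^* d = (m l)^2, whereas
    d^* d + d d^* is always positive; so d = 0 by [neg_starM_eq0], that is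
    h m = 0, and m = 0 since m^2 = b m - h m = - 2 h m. *)
Lemma posA_starM c : posA (star c * c).
Proof.
pose h := star c * c; have hsa : selfadj h by exact: selfadj_starM.
have [b [pb bb bc]] := posA_sqrt (posA_sqr hsa).
have [l [pl ll lc]] := posA_sqrt pb.
have hb : h * b = b * h by apply: bc; rewrite mulrA.
have hl : h * l = l * h by exact: lc.
have bl : b * l = l * b by exact: lc.
pose m := b - h; have sb := posA_selfadj pb.
have sm : selfadj m by exact: selfadjB.
have ml : m * l = l * m by rewrite /m mulrBl mulrBr hl bl.
have hm : h * m = - (b * m) by rewrite /m !mulrBr bb hb; ncring.
pose d := c * m; have d0 : d = 0.
  have pn : posA (- (star d * d)).
    have -> : - (star d * d) = (m * l) * (m * l).
      rewrite /d starMm sm; have -> : m * star c * (c * m) = m * (h * m) by rewrite /h !mulrA.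
      by rewrite hm mulrN opprK -ll {2}ml -!mulrA.
    by apply: posA_sqr; apply: selfadjM => //; exact: posA_selfadj.
  apply: neg_starM_eq0 => //.
  (* With p and q the real and imaginary parts of d, P = 2 p and Q = - 2 q. *)
  pose P := d + star d; pose Q := 'i%C *: (d - star d).
  have sP : selfadj P by rewrite /selfadj starD starK addrC.
  have sQ : selfadj Q by rewrite /selfadj starZi starB starK -scalerN opprB.
  have QQ : Q * Q = - ((d - star d) * (d - star d)).
    by rewrite /Q -scalerAr -scalerAl scalerA -expr2 sqr_i scaleN1r.
  have -> : d * star d = realA A 2^-1 * (P * P + Q * Q) + - (star d * d).
    rewrite QQ; have -> : P * P - (d - star d) * (d - star d) =
       (1 + 1) * (d * star d + star d * d) by rewrite /P; ncring.
    rewrite -realA1 -realAD mulrA -realAM mulVf ?pnatr_eq0// realA1 mul1r addrK //.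
  by apply: posAD => //; apply: posAZ; [rewrite invr_ge0|apply: posAD; exact: posA_sqr].
have hm0 : h * m = 0 by rewrite /h -mulrA -/d d0 mulr0.
have mm : m * m = 0.
  have -> : m * m = b * m - h * m by rewrite /m; ncring.
  by rewrite hm0 subr0 -[LHS]opprK -hm hm0 oppr0.
have m0 : m = 0.
  by apply: normR_eq0; apply/eqP; rewrite -sqrf_eq0 -normR_sqr_sa// mm normR0.
have -> : star c * c = b by apply/eqP; rewrite eq_sym -subr_eq0 -/h -/m m0.
exact: pb.
Qed.

Lemma posA_Mstar c : posA (c * star c).
Proof. by rewrite -{1}[c]starK; exact: posA_starM. Qed.

Lemma cstar_leP a b : cstar_le a b <-> posA (b - a).
Proof.
split; first by move=> [c ->]; exact: posA_starM.
by move=> [c sc e]; exists c; rewrite -e sc.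
Qed.

Lemma posA_conj c a : posA a -> posA (c * a * star c).
Proof.
move=> [b sb <-].
have -> : c * (b * b) * star c = c * b * star (c * b) by rewrite starMm sb !mulrA.
exact: posA_Mstar.
Qed.

Lemma normR_mono a b : posA a -> posA (b - a) -> normR a <= normR b.
Proof.
move=> pa pb; apply: posA_normR_le; rewrite ?normR_ge0//.
have -> : realA A (normR b) - a = (realA A (normR b) - b) + (b - a) by ncring.
apply: posAD => //; apply: posA_realAB => //.
by rewrite -[b](subrK a); apply: selfadjD; exact: posA_selfadj.
Qed.

(** The hypothesis says that <a x + y, a x + y> is positive for every a, where
    p = <x, x>, r = <x, y>, q = <y, y>.  The choice a = - r^* / P with P > |p|
    yields r^* r <= P q. *)
Lemma cauchy_schwarz_posA (p q r : A) : posA p ->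
  (forall a, posA (a * p * star a + a * r + star r * star a + q)) ->
  normR r ^+ 2 <= normR p * normR q.
Proof.
move=> pp H; apply/ler_addgt0Pr => e e0.
have posq : posA q by have := H 0; rewrite star0 !mul0r mulr0 !add0r.
pose Q := normR q + 1; have Q0 : 0 < Q by rewrite ltr_wpDl ?normR_ge0.
pose P := normR p + e / Q; have eQ : 0 < e / Q by rewrite divr_gt0.
have P0 : 0 < P by rewrite ltr_wpDl ?normR_ge0.
have h : posA (q - realA A P^-1 * (star r * r)).
  pose a := - (realA A P^-1 * star r).
  have sa_ : star a = - (realA A P^-1 * r).
    by rewrite starN starMm starK selfadj_realA realAC.
  have -> : q - realA A P^-1 * (star r * r) =
     (a * p * star a + a * r + star r * star a + q) + a * (realA A P - p) * star a.
    have e1 : a * realA A P * star a = realA A P^-1 * (star r * r).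
      rewrite sa_ /a !mulrN !mulNr opprK -!mulrA realAMA divff ?gt_eqF// realA1 mul1r //.
    have e2 : a * r = - (realA A P^-1 * (star r * r)) by rewrite /a mulNr mulrA.
    have e3 : star r * star a = - (realA A P^-1 * (star r * r)).
      by rewrite sa_ mulrN [star r * (_ * _)]mulrA [star r * realA _ _]realAC -mulrA.
    rewrite mulrBr mulrBl e1 e2 e3; ncring.
  apply: posAD => //; apply: posA_conj; apply: posA_realAB; first exact: posA_selfadj.
  by rewrite lerDl ltW.
have Pi : 0 <= P^-1 by rewrite invr_ge0 ltW.
have := normR_mono (posAZ Pi (posA_starM r)) h; rewrite normR_realAM normR_starM ger0_norm//.
rewrite ler_pdivrMl// => h2; apply: le_trans h2 _; rewrite /P mulrDl lerD2l.
by rewrite mulrAC ler_pdivrMr// ler_wpM2l ?(ltW e0)// /Q lerDl.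
Qed.

(** p + e = t (1 - x) with t = |p| + e and |x| < 1, so that p + e and its square
    root k are invertible. *)
Lemma inv_sqrt p e : posA p -> 0 < e -> exists h k,
  [/\ selfadj h, selfadj k, h * k = 1, k * h = 1 & k * k = p + realA A e].
Proof.
move=> pp e0; pose t := normR p + e; have t0 : 0 < t by rewrite ltr_wpDl ?normR_ge0.
have tn0 : t != 0 by rewrite gt_eqF.
pose x := realA A t^-1 * (realA A (normR p) - p).
have ex : p + realA A e = realA A t * (1 - x).
  rewrite mulrBr mulr1 /x realAMA divff// realA1 mul1r /t realAD; ncring.
have x1 : normR x < 1.
  have ti : 0 <= t^-1 by rewrite invr_ge0 ltW.
  rewrite normR_realAM ger0_norm// ltr_pdivrMl// mulr1.
  by apply: le_lt_trans (posA_bound pp (lexx _)) _; rewrite ltrDl.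
have [w [w1 w2]] := geo_inv x1.
have [k [pk kk _]] := posA_sqrt (posAD pp (posA_realA A (ltW e0))).
pose u := realA A t^-1 * w.
have i1 : u * (k * k) = 1.
  by rewrite /u kk ex -realAC -mulrA realAMA mulVf// realA1 mul1r.
have i2 : (k * k) * u = 1.
  by rewrite /u kk ex -[_ * (1 - x)]realAC -mulrA realAMA divff// realA1 mul1r.
pose h := k * u; have kh : k * h = 1 by rewrite mulrA i2.
have hk : h * k = 1.
  have -> : h = u * k by rewrite -[LHS]mul1r -i1 -mulrA -[k * k * h]mulrA kh mulr1.
  by rewrite -mulrA i1.
exists h, k; split; [|exact: posA_selfadj|exact: hk|exact: kh|exact: kk].
by rewrite /selfadj -[star h]mulr1 -kh mulrA -{1}(posA_selfadj pk) -starMm kh star1 mul1r.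
Qed.

End PositiveCone.

(** * Finite blocks of the inner product *)

Section Blocks.
Context (R : realType) (A : cstarAlgType R).
Implicit Types (a b c : A) (x y z : nat -> A) (r s t e : R).

(** Blocks of the inner product decide membership in H_A by Cauchy's criterion,
    and the inner product itself is their limit. *)
Definition blk_inner m n x y : A := \sum_(m <= i < n) x i * star (y i).

Lemma blk_innerDl m n x y z : blk_inner m n (x + y) z = blk_inner m n x z + blk_inner m n y z.
Proof. by rewrite /blk_inner -big_split /=; apply: eq_bigr => i _; rewrite -mulrDl. Qed.

Lemma blk_inner_lact m n a x y : blk_inner m n (lact a x) y = a * blk_inner m n x y.
Proof. by rewrite /blk_inner mulr_sumr; apply: eq_bigr => i _; rewrite /lact mulrA. Qed.

Lemma star_blk_inner m n x y : star (blk_inner m n x y) = blk_inner m n y x.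
Proof.
by rewrite /blk_inner star_sum; apply: eq_bigr => i _; rewrite starMm starK.
Qed.

Lemma blk_inner_cat m n p x y : (m <= n)%N -> (n <= p)%N ->
  blk_inner m p x y = blk_inner m n x y + blk_inner n p x y.
Proof. by move=> mn np; rewrite /blk_inner -big_cat_nat. Qed.

Lemma blk_inner0 m n y : blk_inner m n 0 y = 0.
Proof. by rewrite /blk_inner big1// => i _; rewrite mul0r. Qed.

Lemma blk_inner_posA m n x : posA (blk_inner m n x x).
Proof.
apply: (big_ind (@posA R A)); [exact: posA0|exact: posAD|by move=> i _; exact: posA_Mstar].
Qed.

End Blocks.

(** Both the blocks, defined on all sequences, and the inner product of H_A
    satisfy the following hypotheses. *)
Section SesquiForm.
Context (R : realType) (A : cstarAlgType R).
Implicit Types (a b c : A) (x y z : nat -> A) (r s t e : R).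
Variables (X : set (nat -> A)) (B : (nat -> A) -> (nat -> A) -> A).
Hypothesis X_lact : forall a x, X x -> X (lact a x).
Hypothesis X_D : forall x y, X x -> X y -> X (x + y).
Hypothesis B_star : forall x y, X x -> X y -> star (B x y) = B y x.
Hypothesis B_D : forall x y z, X x -> X y -> X z -> B (x + y) z = B x z + B y z.
Hypothesis B_lact : forall a x y, X x -> X y -> B (lact a x) y = a * B x y.
Hypothesis B_posA : forall x, X x -> posA (B x x).

Lemma form_Dr x y z : X x -> X y -> X z -> B x (y + z) = B x y + B x z.
Proof.
by move=> Xx Xy Xz; rewrite -B_star// ?B_D// ?starD ?B_star//; exact: X_D.
Qed.

Lemma form_lactr a x y : X x -> X y -> B x (lact a y) = B x y * star a.
Proof.
by move=> Xx Xy; rewrite -B_star// ?B_lact// ?starMm ?B_star//; exact: X_lact.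
Qed.

Lemma form_sqrD x y : X x -> X y ->
  B (x + y) (x + y) = B x x + B x y + (B y x + B y y).
Proof. by move=> Xx Xy; rewrite B_D ?form_Dr//; exact: X_D. Qed.

Lemma form_CS x y : X x -> X y -> normR (B x y) ^+ 2 <= normR (B x x) * normR (B y y).
Proof.
move=> Xx Xy; apply: cauchy_schwarz_posA; first exact: B_posA.
move=> a; have Xax := X_lact a Xx.
have <- : B (lact a x + y) (lact a x + y) =
    a * B x x * star a + a * B x y + star (B x y) * star a + B y y.
  by rewrite form_sqrD// !form_lactr// !B_lact// B_star// addrA.
by apply: B_posA; exact: X_D.
Qed.

Definition form_norm x : R := Num.sqrt (normR (B x x)).

Lemma form_norm_sqr x : form_norm x ^+ 2 = normR (B x x).
Proof. by rewrite sqr_sqrtr ?normR_ge0. Qed.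

Lemma form_norm_ge0 x : 0 <= form_norm x. Proof. exact: sqrtr_ge0. Qed.

Lemma form_norm_CS x y : X x -> X y -> normR (B x y) <= form_norm x * form_norm y.
Proof.
move=> Xx Xy; rewrite -(@ler_pXn2r _ 2)// ?nnegrE ?normR_ge0 ?mulr_ge0 ?form_norm_ge0//.
by rewrite exprMn !form_norm_sqr form_CS.
Qed.

Lemma form_normD x y : X x -> X y -> form_norm (x + y) <= form_norm x + form_norm y.
Proof.
move=> Xx Xy; rewrite -(@ler_pXn2r _ 2)// ?nnegrE ?addr_ge0 ?form_norm_ge0//.
rewrite form_norm_sqr form_sqrD// sqrrD !form_norm_sqr.
have := form_norm_CS Xx Xy; have := form_norm_CS Xy Xx.
have := normRD (B x x + B x y) (B y x + B y y); have := normRD (B x x) (B x y).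
have := normRD (B y x) (B y y); rewrite mulr2n [form_norm y * _]mulrC; lra.
Qed.

Lemma form_norm_lact a x : X x -> form_norm (lact a x) <= normR a * form_norm x.
Proof.
move=> Xx; rewrite -(@ler_pXn2r _ 2)// ?nnegrE ?mulr_ge0 ?normR_ge0 ?form_norm_ge0//.
rewrite exprMn !form_norm_sqr form_lactr ?B_lact//; last exact: X_lact.
apply: le_trans (normRM _ _) _; rewrite normR_star.
by have := normRM a (B x x); have := normR_ge0 a; nra.
Qed.

End SesquiForm.

(** * The Hilbert module of square-summable sequences *)

Section HilbertModule.
Context (R : realType) (A : cstarAlgType R).
Implicit Types (a b c : A) (x y z : nat -> A) (r s t e : R).

Definition blk_norm m n x : R := form_norm (blk_inner m n) x.

Lemma blk_norm_ge0 m n x : 0 <= blk_norm m n x. Proof. exact: form_norm_ge0. Qed.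

Lemma blk_inner_CS m n x y : normR (blk_inner m n x y) <= blk_norm m n x * blk_norm m n y.
Proof.
apply: (@form_norm_CS _ _ setT) => //; move=> *;
  by [exact: star_blk_inner|exact: blk_innerDl|exact: blk_inner_lact|exact: blk_inner_posA].
Qed.

Lemma blk_normD m n x y : blk_norm m n (x + y) <= blk_norm m n x + blk_norm m n y.
Proof.
apply: (@form_normD _ _ setT) => //; move=> *;
  by [exact: star_blk_inner|exact: blk_innerDl|exact: blk_inner_lact|exact: blk_inner_posA].
Qed.

Lemma blk_norm_lact m n a x : blk_norm m n (lact a x) <= normR a * blk_norm m n x.
Proof.
apply: (@form_norm_lact _ _ setT) => //; move=> *;
  by [exact: star_blk_inner|exact: blk_innerDl|exact: blk_inner_lact|exact: blk_inner_posA].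
Qed.

Lemma blk_norm_sqr m n x : blk_norm m n x ^+ 2 = normR (blk_inner m n x x).
Proof. exact: form_norm_sqr. Qed.

Lemma lactN1 x : lact (-1) x = - x.
Proof. by apply/funext => i; rewrite /lact mulN1r. Qed.

Lemma lact0 x : lact 0 x = 0.
Proof. by apply/funext => i; rewrite /lact mul0r. Qed.

Lemma lactr0 a : lact a 0 = 0 :> (nat -> A).
Proof. by apply/funext => i; rewrite /lact mulr0. Qed.

Lemma lact1 x : lact 1 x = x.
Proof. by apply/funext => i; rewrite /lact mul1r. Qed.

Lemma lactD a b x : lact (a + b) x = lact a x + lact b x.
Proof. by apply/funext => i; rewrite /lact mulrDl. Qed.

Lemma lactDr a x y : lact a (x + y) = lact a x + lact a y.
Proof. by apply/funext => i; rewrite /lact mulrDr. Qed.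

Lemma lactA a b x : lact a (lact b x) = lact (a * b) x.
Proof. by apply/funext => i; rewrite /lact mulrA. Qed.


Lemma seriesE (u : nat -> A) n : series u n = \sum_(0 <= i < n) u i.
Proof. by []. Qed.

Lemma HA_blkP x : HA A x <-> forall e, 0 < e ->
  exists N, forall m n, (N <= m)%N -> (m <= n)%N -> blk_norm m n x < e.
Proof.
split.
  move=> /cvg_ex[l /cvgAP xl] e e0.
  have e2 : 0 < e ^+ 2 / 2 by rewrite divr_gt0 ?exprn_gt0.
  have [N H] := xl _ e2; exists N => m n Nm mn.
  rewrite -(@ltr_pXn2r _ 2)// ?nnegrE ?blk_norm_ge0 ?(ltW e0)// blk_norm_sqr.
  have -> : blk_inner m n x x = (series (fun i => x i * star (x i)) n - l) -
                         (series (fun i => x i * star (x i)) m - l).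
    rewrite !seriesE -/(blk_inner 0 n x x) -/(blk_inner 0 m x x) (blk_inner_cat x x (leq0n m) mn); ncring.
  have := H m Nm; have := H n (leq_trans Nm mn); set p := _ - l; set q := _ - l.
  by have := normRD p (- q); rewrite normRN; lra.
move=> H; apply/cvg_ex; eexists; apply/cvgAP; apply: cauchyA => e e0.
have se : 0 < Num.sqrt e by rewrite sqrtr_gt0.
have [N HN] := H _ se; exists N => m n Nm mn; have := HN m n Nm mn.
rewrite -(@ltr_pXn2r _ 2)// ?nnegrE ?blk_norm_ge0 ?sqrtr_ge0// blk_norm_sqr sqr_sqrtr ?(ltW e0)//.
have -> // : blk_inner m n x x = series (fun i => x i * star (x i)) n -
                         series (fun i => x i * star (x i)) m.
rewrite !seriesE -/(blk_inner 0 n x x) -/(blk_inner 0 m x x) (blk_inner_cat x x (leq0n m) mn); ncring.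
Qed.

Lemma HA0 : HA A 0.
Proof.
apply/HA_blkP => e e0; exists 0%N => m n _ _.
by rewrite /blk_norm /form_norm blk_inner0 normR0 sqrtr0.
Qed.

Lemma HA_D x y : HA A x -> HA A y -> HA A (x + y).
Proof.
move=> /HA_blkP Hx /HA_blkP Hy; apply/HA_blkP => e e0.
have e2 : 0 < e / 2 by rewrite divr_gt0.
have [N HN] := Hx _ e2; have [N' HN'] := Hy _ e2.
exists (maxn N N') => m n; rewrite geq_max => /andP[Nm N'm] mn.
apply: le_lt_trans (blk_normD _ _ _ _) _.
have := HN _ _ Nm mn; have := HN' _ _ N'm mn; lra.
Qed.

Lemma HA_lact a x : HA A x -> HA A (lact a x).
Proof.
move=> /HA_blkP Hx; apply/HA_blkP => e e0.
have C0 : 0 < normR a + 1 by rewrite ltr_wpDl ?normR_ge0.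
have e2 : 0 < e / (normR a + 1) by rewrite divr_gt0.
have [N HN] := Hx _ e2; exists N => m n Nm mn.
apply: le_lt_trans (blk_norm_lact _ _ _ _) _; have := HN _ _ Nm mn.
rewrite ltr_pdivlMr//; have := blk_norm_ge0 m n x; have := normR_ge0 a; nra.
Qed.

Lemma HA_N x : HA A x -> HA A (- x).
Proof. by move=> Hx; rewrite -lactN1; exact: HA_lact. Qed.

Lemma HA_B x y : HA A x -> HA A y -> HA A (x - y).
Proof. by move=> Hx Hy; apply: HA_D => //; exact: HA_N. Qed.

Lemma hinner_cvg x y : HA A x -> HA A y -> cvgA (fun n => blk_inner 0 n x y) (hinner x y).
Proof.
move=> /HA_blkP Hx /HA_blkP Hy; apply: cauchyA => e e0.
have [N HN] := Hx _ e0; have [N' HN'] := Hy _ ltr01.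
exists (maxn N N') => m n; rewrite geq_max => /andP[Nm N'm] mn.
rewrite (blk_inner_cat x y (leq0n m) mn) addrAC subrr add0r.
apply: le_lt_trans (blk_inner_CS _ _ _ _) _.
have := HN _ _ Nm mn; have := HN' _ _ N'm mn; have := blk_norm_ge0 m n x; have := blk_norm_ge0 m n y.
nra.
Qed.

Lemma hinner_star x y : HA A x -> HA A y -> star (hinner x y) = hinner y x.
Proof.
move=> Hx Hy; apply: cvgA_unique (cvgA_star (hinner_cvg Hx Hy)) _.
under eq_fun do rewrite star_blk_inner.
exact: hinner_cvg.
Qed.

Lemma hinnerDl x y z : HA A x -> HA A y -> HA A z ->
  hinner (x + y) z = hinner x z + hinner y z.
Proof.
move=> Hx Hy Hz; apply: cvgA_unique (hinner_cvg (HA_D Hx Hy) Hz) _.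
under eq_fun do rewrite blk_innerDl.
by apply: cvgAD; exact: hinner_cvg.
Qed.

Lemma hinner_lactl a x y : HA A x -> HA A y -> hinner (lact a x) y = a * hinner x y.
Proof.
move=> Hx Hy; have h := hinner_cvg (HA_lact (a := a) Hx) Hy.
suff h' : cvgA (fun n => blk_inner 0 n (lact a x) y) (a * hinner x y).
  by rewrite (cvgA_unique h h').
under eq_fun do rewrite blk_inner_lact.
by apply: cvgAM; [exact: cvgA_cst|exact: hinner_cvg].
Qed.

Lemma hinner_posA x : HA A x -> posA (hinner x x).
Proof. by move=> Hx; apply: posA_cvg (hinner_cvg Hx Hx) _ => n; exact: blk_inner_posA. Qed.

Lemma hinnerDr x y z : HA A x -> HA A y -> HA A z ->
  hinner x (y + z) = hinner x y + hinner x z.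
Proof.
apply: (@form_Dr _ _ (HA A)); by [exact: HA_D|exact: hinner_star|exact: hinnerDl].
Qed.

Lemma hinner_lactr a x y : HA A x -> HA A y -> hinner x (lact a y) = hinner x y * star a.
Proof.
apply: (@form_lactr _ _ (HA A)); by [exact: HA_lact|exact: hinner_star|exact: hinner_lactl].
Qed.


Lemma hnorm_ge0 x : 0 <= hnorm x. Proof. exact: form_norm_ge0. Qed.

Lemma hnorm_sqr x : hnorm x ^+ 2 = normR (hinner x x). Proof. exact: form_norm_sqr. Qed.

Lemma hinner_CS x y : HA A x -> HA A y -> normR (hinner x y) <= hnorm x * hnorm y.
Proof.
apply: (@form_norm_CS _ _ (HA A)).
- exact: HA_lact.
- exact: HA_D.
- exact: hinner_star.
- exact: hinnerDl.
- exact: hinner_lactl.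
- exact: hinner_posA.
Qed.

Lemma hnormD x y : HA A x -> HA A y -> hnorm (x + y) <= hnorm x + hnorm y.
Proof.
apply: (@form_normD _ _ (HA A)).
- exact: HA_lact.
- exact: HA_D.
- exact: hinner_star.
- exact: hinnerDl.
- exact: hinner_lactl.
- exact: hinner_posA.
Qed.

Lemma hnorm_lact a x : HA A x -> hnorm (lact a x) <= normR a * hnorm x.
Proof.
apply: (@form_norm_lact _ _ (HA A)).
- exact: HA_lact.
- exact: hinner_star.
- exact: hinner_lactl.
Qed.


Lemma hnormN x : hnorm (- x) = hnorm x.
Proof.
rewrite /hnorm; congr (Num.sqrt (complex.Re `|limn _|)); apply/funext => n.
by rewrite !seriesE; apply: eq_bigr => i _; rewrite starN mulrNN.
Qed.

Lemma hnormBC x y : hnorm (x - y) = hnorm (y - x).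
Proof. by rewrite -hnormN opprB. Qed.

Lemma hnormB x y : HA A x -> HA A y -> hnorm (x - y) <= hnorm x + hnorm y.
Proof. by move=> Hx Hy; rewrite -[hnorm y]hnormN; apply: hnormD => //; exact: HA_N. Qed.

Lemma hnorm_triangle x y z : HA A x -> HA A y -> HA A z ->
  hnorm (x - z) <= hnorm (x - y) + hnorm (y - z).
Proof.
move=> Hx Hy Hz; have := hnormD (HA_B Hx Hy) (HA_B Hy Hz).
by rewrite addrA subrK.
Qed.

Lemma hinner0l y : hinner 0 y = 0 :> A.
Proof.
apply: cvgA_lim; suff -> : series (fun i => (0 : nat -> A) i * star (y i)) = fun=> 0 by exact: cvgA_cst.
by apply/funext => n; rewrite seriesE -/(blk_inner 0 n 0 y) blk_inner0.
Qed.

Lemma hnorm0 : hnorm (0 : nat -> A) = 0.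
Proof. by rewrite /hnorm hinner0l normr0 sqrtr0. Qed.

Lemma blk_inner_le_hinner n x : HA A x -> posA (hinner x x - blk_inner 0 n x x).
Proof.
move=> Hx; have c := cvgAB (hinner_cvg Hx Hx) (cvgA_cst (blk_inner 0 n x x)).
have c' : cvgA (fun k => blk_inner 0 (n + k) x x - blk_inner 0 n x x) (hinner x x - blk_inner 0 n x x).
  move=> e /c[N H]; exists N => k Nk; apply: H; exact: leq_trans Nk (leq_addl _ _).
apply: posA_cvg c' _ => k.
rewrite (blk_inner_cat x x (leq0n n) (leq_addr k n)) addrAC subrr add0r; exact: blk_inner_posA.
Qed.

Lemma blk_norm_le_hnorm m n x : HA A x -> blk_norm m n x <= hnorm x.
Proof.
move=> Hx; have [mn|nm] := leqP m n; last first.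
  by rewrite /blk_norm /form_norm /blk_inner big_geq ?(ltnW nm)// normR0 sqrtr0 hnorm_ge0.
rewrite -(@ler_pXn2r _ 2)// ?nnegrE ?blk_norm_ge0 ?hnorm_ge0// blk_norm_sqr hnorm_sqr.
apply: normR_mono; first exact: blk_inner_posA.
have -> : hinner x x - blk_inner m n x x = (hinner x x - blk_inner 0 n x x) + blk_inner 0 m x x.
  rewrite (blk_inner_cat x x (leq0n m) mn); ncring.
by apply: posAD; [exact: blk_inner_le_hinner|exact: blk_inner_posA].
Qed.

Lemma hnorm_le_blk C x : HA A x -> 0 <= C -> (forall n, blk_norm 0 n x <= C) -> hnorm x <= C.
Proof.
move=> Hx C0 H; rewrite -(@ler_pXn2r _ 2)// ?nnegrE ?hnorm_ge0// hnorm_sqr.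
apply: cvgA_normR_le (hinner_cvg Hx Hx) _; exists 0%N => n _.
by rewrite -blk_norm_sqr ler_pXn2r ?nnegrE ?blk_norm_ge0.
Qed.

Lemma coord_blk_norm j x : normR (x j) = blk_norm j j.+1 x.
Proof.
by rewrite /blk_norm /form_norm /blk_inner big_nat1 normR_Mstar sqrtr_sqr ger0_norm ?normR_ge0.
Qed.

Lemma coord_le_hnorm j x : HA A x -> normR (x j) <= hnorm x.
Proof. by move=> Hx; rewrite coord_blk_norm blk_norm_le_hnorm. Qed.

Lemma hnorm_eq0 x : HA A x -> hnorm x = 0 -> x = 0.
Proof.
move=> Hx x0; apply/funext => j; apply: normR_eq0; apply/eqP.
by rewrite eq_le normR_ge0 andbT -x0 coord_le_hnorm.
Qed.

Definition hcvg (u : nat -> nat -> A) x := forall e, 0 < e ->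
  exists N, forall n, (N <= n)%N -> hnorm (u n - x) < e.

Lemma blk_norm_cvg m n (u : nat -> nat -> A) x C : (forall j, cvgA (u^~ j) (x j)) ->
  0 <= C -> (exists N, forall k, (N <= k)%N -> blk_norm m n (u k) <= C) -> blk_norm m n x <= C.
Proof.
move=> cu C0 [N H]; rewrite -(@ler_pXn2r _ 2)// ?nnegrE ?blk_norm_ge0// blk_norm_sqr.
have c : cvgA (fun k => blk_inner m n (u k) (u k)) (blk_inner m n x x).
  rewrite /blk_inner; elim: (index_iota m n) => [|i l IH].
    by under eq_fun do rewrite big_nil; rewrite big_nil; exact: cvgA_cst.
  under eq_fun do rewrite big_cons; rewrite big_cons; apply: cvgAD => //.
  by apply: cvgAM; [exact: cu|exact: cvgA_star (cu i)].
apply: cvgA_normR_le c _; exists N => k Nk.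
by rewrite -blk_norm_sqr ler_pXn2r ?nnegrE ?blk_norm_ge0 ?H.
Qed.

(** The pointwise limit is the limit in norm: Cauchy estimates on blocks pass to
    pointwise limits. *)
Lemma HA_complete (u : nat -> nat -> A) : (forall n, HA A (u n)) ->
  (forall e, 0 < e -> exists N, forall m n, (N <= m)%N -> (m <= n)%N ->
     hnorm (u n - u m) < e) ->
  exists x, HA A x /\ hcvg u x.
Proof.
move=> Hu uC; pose x j := limn (u^~ j).
have cx j : cvgA (u^~ j) (x j).
  apply: cauchyA => e /uC[N H]; exists N => m n Nm mn.
  exact: le_lt_trans (coord_le_hnorm j (HA_B (Hu n) (Hu m))) (H _ _ Nm mn).
have bx e : 0 < e -> exists N, forall k m n, (N <= k)%N -> blk_norm m n (x - u k) <= e.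
  move=> e0; have [N H] := uC e e0; exists N => k m n Nk.
  apply: (@blk_norm_cvg _ _ (fun l => u l - u k)); last 2 first.
  - exact: ltW.
  - exists k => l kl; apply: ltW; apply: le_lt_trans (H _ _ Nk kl).
    by apply: blk_norm_le_hnorm; exact: HA_B.
  - by move=> j; apply: cvgAB => //; exact: cvgA_cst.
have Hx : HA A x.
  apply/HA_blkP => e e0; have e2 : 0 < e / 2 by rewrite divr_gt0.
  have [N H] := bx _ e2; have /HA_blkP/(_ _ e2)[N' H'] := Hu N.
  exists N' => m n N'm mn; rewrite -[x](subrK (u N)).
  apply: le_lt_trans (blk_normD _ _ _ _) _.
  have := H N m n (leqnn N); have := H' m n N'm mn; lra.
exists x; split=> // e e0; have e2 : 0 < e / 2 by rewrite divr_gt0.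
have [N H] := bx _ e2; exists N => k Nk; rewrite hnormBC.
apply: (@le_lt_trans _ _ (e / 2)); last lra.
by apply: hnorm_le_blk; [exact: HA_B|exact: ltW|move=> n; exact: H].
Qed.

Lemma hcvg_unique (u : nat -> nat -> A) x y : (forall n, HA A (u n)) -> HA A x -> HA A y ->
  hcvg u x -> hcvg u y -> x = y.
Proof.
move=> Hu Hx Hy ux uy; apply/eqP; rewrite -subr_eq0; apply/eqP.
apply: hnorm_eq0; first exact: HA_B.
apply/eqP; rewrite eq_le hnorm_ge0 andbT; apply/ler_addgt0Pr => e e0; rewrite add0r.
have e2 : 0 < e / 2 by rewrite divr_gt0.
have [N H] := ux _ e2; have [N' H'] := uy _ e2.
have := H _ (leq_maxl N N'); have := H' _ (leq_maxr N N').
have := hnorm_triangle Hx (Hu (maxn N N')) Hy; rewrite [hnorm (x - u _)]hnormBC; lra.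
Qed.

Definition trunc n x : nat -> A := fun i => if (i < n)%N then x i else 0.

Lemma trunc_cvg x : HA A x -> (forall n, HA A (trunc n x)) /\ hcvg (trunc^~ x) x.
Proof.
move=> Hx.
have bt n m k : blk_norm m k (trunc n x) <= blk_norm m k x.
  rewrite -(@ler_pXn2r _ 2)// ?nnegrE ?blk_norm_ge0// !blk_norm_sqr; apply: normR_mono; first exact: blk_inner_posA.
  rewrite /blk_inner -sumrB; apply: (big_ind (@posA R A)); [exact: posA0|exact: posAD|move=> i _].
  rewrite /trunc; case: ifP => _; first by rewrite subrr; exact: posA0.
  by rewrite mul0r subr0; exact: posA_Mstar.
have Ht n : HA A (trunc n x).
  have /HA_blkP Hx' := Hx; apply/HA_blkP => e /Hx'[N H]; exists N => m k Nm mk.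
  exact: le_lt_trans (bt _ _ _) (H _ _ Nm mk).
split=> // e e0; have e2 : 0 < e / 2 by rewrite divr_gt0.
have /HA_blkP/(_ _ e2)[N H] := Hx; exists N => n Nn; rewrite hnormBC.
apply: (@le_lt_trans _ _ (e / 2)); last lra.
apply: hnorm_le_blk; [exact: HA_B|exact: ltW|move=> k].
have [nk|kn] := leqP n k.
  have -> : blk_norm 0 k (x - trunc n x) = blk_norm n k x.
    rewrite /blk_norm /form_norm; congr (Num.sqrt (normR _)); rewrite (blk_inner_cat _ _ (leq0n n) nk).
    rewrite [X in X + _]big_nat big1 ?add0r; last first.
      by move=> i /andP[_ iln]; rewrite !fctE /trunc iln subrr mul0r.
    rewrite /blk_inner big_nat [RHS]big_nat; apply: eq_bigr => i /andP[ni _].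
    by rewrite !fctE /trunc ltnNge ni /= subr0.
  by apply: ltW; apply: H.
have -> : blk_norm 0 k (x - trunc n x) = 0.
  rewrite /blk_norm /form_norm /blk_inner big_nat big1 ?normR0 ?sqrtr0// => i /andP[_ ik].
  by rewrite !fctE /trunc (ltn_trans ik kn) subrr mul0r.
exact: ltW.
Qed.

End HilbertModule.

(** * Bounded operators on H_A *)

Lemma choice_on (S U : Type) (u0 : U) (X : set S) (P : S -> U -> Prop) :
  (forall y, X y -> exists x, P y x) -> exists F, forall y, X y -> P y (F y).
Proof.
move=> H; exists (fun y => if pselect (exists x, P y x) is left h then projT1 (cid h) else u0).
by move=> y /H h; case: pselect => // h'; exact: projT2 (cid h').
Qed.

Section Operators.
Context (R : realType) (A : cstarAlgType R).
Implicit Types (a b c : A) (x y z : nat -> A) (r s t e C D : R)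
  (T K : (nat -> A) -> nat -> A) (f g : nat -> nat -> A).

(** The bound C is kept as a parameter because the perturbation argument
    compares norms of operators. *)
Definition bounded_op C T := [/\ 0 <= C, forall x, HA A x -> HA A (T x),
  forall a x y, HA A x -> HA A y -> T (lact a x + y) = lact a (T x) + T y &
  forall x, HA A x -> hnorm (T x) <= C * hnorm x].

Section Bop.
Variables (C : R) (T : (nat -> A) -> nat -> A).
Hypothesis bT : bounded_op C T.

Lemma bounded_op_ge0 : 0 <= C. Proof. by case: bT. Qed.
Lemma bounded_op_HA x : HA A x -> HA A (T x). Proof. by case: bT => _ + _ _; apply. Qed.
Lemma bounded_op_lin a x y : HA A x -> HA A y -> T (lact a x + y) = lact a (T x) + T y.
Proof. by case: bT => _ _ + _; apply. Qed.
Lemma bounded_op_le x : HA A x -> hnorm (T x) <= C * hnorm x.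
Proof. by case: bT => _ _ _; apply. Qed.
Lemma bounded_op0 : T 0 = 0.
Proof.
have := bounded_op_lin (-1) (@HA0 R A) (@HA0 R A).
by rewrite !lactN1 oppr0 addr0 addNr.
Qed.
Lemma bounded_op_D x y : HA A x -> HA A y -> T (x + y) = T x + T y.
Proof. by move=> Hx Hy; have := bounded_op_lin 1 Hx Hy; rewrite !lact1. Qed.
Lemma bounded_op_lact a x : HA A x -> T (lact a x) = lact a (T x).
Proof. by move=> Hx; have := bounded_op_lin a Hx (@HA0 R A); rewrite bounded_op0 !addr0. Qed.
Lemma bounded_op_N x : HA A x -> T (- x) = - T x.
Proof. by move=> Hx; rewrite -lactN1 bounded_op_lact// lactN1. Qed.
Lemma bounded_op_B x y : HA A x -> HA A y -> T (x - y) = T x - T y.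
Proof. by move=> Hx Hy; rewrite bounded_op_D ?bounded_op_N//; exact: HA_N. Qed.
Lemma bounded_op_sum (I : Type) (l : seq I) (x : I -> nat -> A) : (forall i, HA A (x i)) ->
  HA A (\sum_(i <- l) x i) /\ T (\sum_(i <- l) x i) = \sum_(i <- l) T (x i).
Proof.
move=> Hx; elim: l => [|i l [H1 H2]]; first by rewrite !big_nil bounded_op0; split=> //; exact: HA0.
by rewrite !big_cons bounded_op_D// H2; split=> //; exact: HA_D.
Qed.
Lemma bounded_op_hcvg u x : (forall n, HA A (u n)) -> HA A x -> hcvg u x ->
  hcvg (T \o u) (T x).
Proof.
move=> Hu Hx ux e e0; have C1 : 0 < C + 1 by rewrite ltr_wpDl ?bounded_op_ge0.
have d0 : 0 < e / (C + 1) by rewrite divr_gt0.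
have [N H] := ux _ d0; exists N => n /H; rewrite ltr_pdivlMr// => h.
rewrite /= -bounded_op_B//; apply: le_lt_trans (bounded_op_le (HA_B (Hu n) Hx)) _.
by have := hnorm_ge0 (u n - x); have := bounded_op_ge0; nra.
Qed.
End Bop.

Lemma bounded_op_of_bounded (X : set (nat -> A)) T : X `<=` HA A -> bounded_Amap (HA A) X T ->
  exists C, bounded_op C T.
Proof.
move=> XH [TX Tl [C TC]]; exists (Num.max C 0); split=> //.
- by rewrite le_max lexx orbT.
- by move=> x /TX /XH.
- move=> x Hx; apply: le_trans (TC x Hx) _; rewrite ler_wpM2r ?hnorm_ge0//.
  by rewrite le_max lexx.
Qed.


Lemma bounded_op_id : bounded_op 1 id.
Proof. by split=> // x; rewrite mul1r. Qed.

Lemma bounded_op_add C D T K : bounded_op C T -> bounded_op D K ->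
  bounded_op (C + D) (fun x => T x + K x).
Proof.
move=> bT bK; split=> [||a x y Hx Hy|x Hx].
- by rewrite addr_ge0 ?(bounded_op_ge0 bT) ?(bounded_op_ge0 bK).
- by move=> x Hx; apply: HA_D; [exact: bounded_op_HA bT _ _|exact: bounded_op_HA bK _ _].
- by rewrite (bounded_op_lin bT)// (bounded_op_lin bK)// lactDr addrACA.
- have h := hnormD (bounded_op_HA bT Hx) (bounded_op_HA bK Hx).
  by have := bounded_op_le bT Hx; have := bounded_op_le bK Hx; rewrite mulrDl; lra.
Qed.

Lemma bounded_op_opp C T : bounded_op C T -> bounded_op C (fun x => - T x).
Proof.
move=> bT; split=> [||a x y Hx Hy|x Hx].
- exact: bounded_op_ge0 bT.
- by move=> x Hx; apply: HA_N; exact: bounded_op_HA bT _ _.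
- by rewrite (bounded_op_lin bT)// -!lactN1 lactDr !lactA mulrN1 mulN1r.
- by rewrite hnormN; exact: bounded_op_le.
Qed.

Lemma bounded_op_comp C D T K : bounded_op C T -> bounded_op D K ->
  bounded_op (C * D) (fun x => T (K x)).
Proof.
move=> bT bK; split=> [||a x y Hx Hy|x Hx].
- by rewrite mulr_ge0 ?(bounded_op_ge0 bT) ?(bounded_op_ge0 bK).
- by move=> x Hx; apply: (bounded_op_HA bT); exact: bounded_op_HA bK _ _.
- by rewrite (bounded_op_lin bK)// (bounded_op_lin bT)//; exact: bounded_op_HA bK _ _.
- apply: le_trans (bounded_op_le bT (bounded_op_HA bK Hx)) _.
  by rewrite -mulrA ler_wpM2l ?(bounded_op_ge0 bT)//; exact: bounded_op_le.
Qed.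

Lemma bounded_op_scale r : bounded_op `|r| (lact (realA A r)).
Proof.
split=> [||a x y Hx Hy|x Hx]; first exact: normr_ge0.
- by move=> x; exact: HA_lact.
- by rewrite lactDr !lactA realAC.
- by rewrite -(normR_realA A); exact: hnorm_lact.
Qed.

(** 1 + K is bounded below by 1 - q, and y = x + K x is solved by iterating
    x |-> y - K x. *)
Lemma neumann q K : bounded_op q K -> q < 1 -> exists S, [/\ bounded_op (1 - q)^-1 S,
  forall y, HA A y -> S y + K (S y) = y & forall x, HA A x -> S (x + K x) = x].
Proof.
move=> bK q1; have q0 := bounded_op_ge0 bK.
have below x : HA A x -> (1 - q) * hnorm x <= hnorm (x + K x).
  move=> Hx; have := hnormB (HA_D Hx (bounded_op_HA bK Hx)) (bounded_op_HA bK Hx).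
  by rewrite addrK; have := bounded_op_le bK Hx; lra.
have inj x y : HA A x -> HA A y -> x + K x = y + K y -> x = y.
  move=> Hx Hy e; apply/eqP; rewrite -subr_eq0; apply/eqP.
  apply: hnorm_eq0; first exact: HA_B.
  have := below _ (HA_B Hx Hy); rewrite (bounded_op_B bK)// addrACA -opprD e subrr hnorm0.
  by rewrite pmulr_rle0 ?subr_gt0// => h; apply/eqP; rewrite eq_le h hnorm_ge0.
have surj y : HA A y -> exists x, HA A x /\ x + K x = y.
  move=> Hy; pose u := fix u n := if n is m.+1 then y - K (u m) else 0 : nat -> A.
  have Hu n : HA A (u n).
    by elim: n => [|n IH] /=; [exact: HA0|apply: HA_B => //; exact: bounded_op_HA bK _ _].
  have uS n : hnorm (u n.+1 - u n) <= hnorm y * q ^+ n.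
    elim: n => [|n IH]; first by rewrite /= subr0 (bounded_op0 bK) subr0 mulr1.
    have -> : u n.+2 - u n.+1 = - K (u n.+1 - u n).
      rewrite (bounded_op_B bK)// /= opprB; set p := K (y - _); set p' := K (u n).
      seqring.
    rewrite hnormN; apply: le_trans (bounded_op_le bK (HA_B (Hu _) (Hu _))) _.
    by rewrite exprS mulrCA ler_wpM2l.
  have [x [Hx ux]] : exists x, HA A x /\ hcvg u x.
    apply: HA_complete => //.
    apply: (@geo_cauchy _ (fun m n => hnorm (u n - u m)) (hnorm y) q) => //.
    - by rewrite q0.
    - exact: hnorm_ge0.
    - by move=> n; rewrite subrr hnorm0.
    - by move=> m n p; have := hnorm_triangle (Hu p) (Hu n) (Hu m); lra.
  exists x; split=> //; suff e : x = y - K x by rewrite {1}e subrK.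
  apply/esym.
  have HKx := bounded_op_HA bK Hx.
  apply: (@hcvg_unique _ _ (fun n => u n.+1)) => //.
  - exact: HA_B.
  - move=> e /(bounded_op_hcvg bK Hu Hx ux)[N H]; exists N => n Nn.
    have -> : u n.+1 - (y - K x) = - (K (u n) - K x).
      rewrite /=; seqring.
    by rewrite hnormN; exact: H.
  - by move=> e /ux[N H]; exists N => n Nn; apply: H; exact: leqW.
have [S SP] := choice_on (0 : nat -> A) surj.
exists S; split.
- split.
  + by rewrite invr_ge0 subr_ge0 ltW.
  + by move=> y /SP[].
  + move=> a x y Hx Hy; have [H1 E1] := SP _ Hx; have [H2 E2] := SP _ Hy.
    have Hxy : HA A (lact a x + y) by apply: HA_D => //; exact: HA_lact.
    have [H3 E3] := SP _ Hxy.
    apply: inj => //; first by apply: HA_D => //; exact: HA_lact.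
    by rewrite E3 (bounded_op_lin bK)// addrACA -lactDr E1 E2.
  + move=> y /SP[H1 E1]; have := below _ H1; rewrite E1 => h.
    by rewrite ler_pdivlMl ?subr_gt0.
- by move=> y /SP[].
- move=> x Hx; have Hy := HA_D Hx (bounded_op_HA bK Hx).
  by have [H1 E1] := SP _ Hy; exact: inj.
Qed.

End Operators.

(** * Bessel sequences: analysis, synthesis and adjunction *)

Section Bessel.
Context (R : realType) (A : cstarAlgType R).
Implicit Types (a b c : A) (x y z : nat -> A) (r s t e C D : R)
  (T K : (nat -> A) -> nat -> A) (f g : nat -> nat -> A).

Definition analysis f x : nat -> A := fun i => hinner x (f i).

(** The Bessel condition in terms of the analysis operator: the sum of
    <x, f_n> <f_n, x> is the inner square of (<x, f_n>)_n. *)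
Definition bessel_by C f := [/\ 0 <= C, forall n, HA A (f n) &
  forall x, HA A x -> HA A (analysis f x) /\
    posA (realA A C * hinner x x - hinner (analysis f x) (analysis f x))].

Lemma bessel_boundP C f : 0 <= C -> (forall n, HA A (f n)) ->
  bessel_bound C f <-> bessel_by C f.
Proof.
move=> C0 Hf.
have E x : HA A x -> series (fun n => hinner x (f n) * hinner (f n) x) =
    series (fun i => analysis f x i * star (analysis f x i)).
  move=> Hx; congr series; apply/funext => i; rewrite /analysis hinner_star//.
split=> [H|[_ _ H]].
  split=> // x Hx; have := H x Hx; rewrite /= E// => -[h1 /cstar_leP h2].
  by split=> //; move: h2; rewrite scale_realA.
move=> x Hx; rewrite /= E//; have [h1 h2] := H x Hx; split=> //.
by apply/cstar_leP; rewrite scale_realA.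
Qed.

Lemma bessel_by_bessel C f : bessel_by C f -> bessel f.
Proof.
move=> [C0 Hf H]; split=> //; exists (C + 1); first by rewrite ltr_wpDl.
apply/bessel_boundP => //; first by rewrite addr_ge0.
split=> //; first by rewrite addr_ge0.
move=> x Hx; have [h1 h2] := H x Hx; split=> //.
rewrite realAD realA1 mulrDl mul1r addrAC; apply: posAD => //; exact: hinner_posA.
Qed.

Lemma bessel_by_analysis C f : bessel_by C f -> bounded_op (Num.sqrt C) (analysis f).
Proof.
move=> [C0 Hf H]; split=> [||a x y Hx Hy|x Hx].
- exact: sqrtr_ge0.
- by move=> x /H[].
- by apply/funext => i; rewrite /analysis hinnerDl ?hinner_lactl//; exact: HA_lact.
- have [h1 h2] := H x Hx.
  rewrite -(@ler_pXn2r _ 2)// ?nnegrE ?mulr_ge0 ?sqrtr_ge0 ?hnorm_ge0//.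
  rewrite exprMn !hnorm_sqr sqr_sqrtr//.
  have := normR_mono (hinner_posA h1) h2; rewrite normR_realAM ger0_norm//.
Qed.

Lemma hinner_sqrD x y : HA A x -> HA A y -> hinner (x + y) (x + y) =
  hinner x x + hinner x y + (hinner y x + hinner y y).
Proof. by move=> Hx Hy; rewrite hinnerDl ?hinnerDr//; exact: HA_D. Qed.

Lemma hinnerNr x y : HA A x -> HA A y -> hinner x (- y) = - hinner x y.
Proof. by move=> Hx Hy; rewrite -lactN1 hinner_lactr// starN star1 mulrN1. Qed.

Lemma hinnerNl x y : HA A x -> HA A y -> hinner (- x) y = - hinner x y.
Proof. by move=> Hx Hy; rewrite -lactN1 hinner_lactl// mulN1r. Qed.

Lemma analysis_add f g x : (forall n, HA A (f n)) -> (forall n, HA A (g n)) -> HA A x ->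
  analysis (fun n => f n + g n) x = analysis f x + analysis g x.
Proof. by move=> Hf Hg Hx; apply/funext => i; rewrite /analysis hinnerDr. Qed.

(** With p and q the analysis sequences of f and g,
    2 <p, p> + 2 <q, q> - <p + q, p + q> = <p - q, p - q>. *)
Lemma bessel_by_add C D f g : bessel_by C f -> bessel_by D g ->
  bessel_by (2 * C + 2 * D) (fun n => f n + g n).
Proof.
move=> [C0 Hf F] [D0 Hg G]; split=> [||x Hx].
- by rewrite addr_ge0 ?mulr_ge0.
- by move=> n; exact: HA_D.
rewrite analysis_add//; have [f1 f2] := F x Hx; have [g1 g2] := G x Hx; split; first exact: HA_D.
set p := analysis f x in f1 f2 *; set q := analysis g x in g1 g2 *.
have posq := hinner_posA (HA_B f1 g1); move: posq.
rewrite !hinner_sqrD//; last exact: HA_N.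
have Nq := HA_N g1; rewrite hinnerNr// hinnerNl// hinnerNr// hinnerNl// opprK => h.
set X := hinner x x in f2 g2 *.
have -> : realA A (2 * C + 2 * D) * X - (hinner p p + hinner p q + (hinner q p + hinner q q))
   = (realA A C * X - hinner p p) + (realA A C * X - hinner p p) +
     ((realA A D * X - hinner q q) + (realA A D * X - hinner q q)) +
     (hinner p p - hinner p q + (- hinner q p + hinner q q)).
  rewrite !mulr_natl !mulr2n !realAD; ncring.
by apply: posAD => //; apply: posAD; apply: posAD.
Qed.

Definition seq_shift k x : nat -> A := fun i => if (i < k)%N then 0 else x (i - k)%N.

Lemma tail_shift k x : seq_tail k (seq_shift k x) = x.
Proof. by apply/funext => i; rewrite /seq_tail /seq_shift ltnNge leq_addr addKn. Qed.

Lemma blk_inner_tail k m n x y :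
  blk_inner m n (seq_tail k x) (seq_tail k y) = blk_inner (k + m) (k + n) x y.
Proof.
rewrite /blk_inner ![(k + _)%N]addnC big_addn addnK.
by apply: eq_bigr => i _; rewrite /seq_tail addnC.
Qed.

Lemma hinner_tail k x y : HA A x -> HA A y ->
  HA A (seq_tail k x) /\ hinner (seq_tail k x) (seq_tail k y) = hinner x y - blk_inner 0 k x y.
Proof.
have HT z : HA A z -> HA A (seq_tail k z).
  move=> /HA_blkP Hz; apply/HA_blkP => e /Hz[N H]; exists N => m n Nm mn.
  rewrite /blk_norm /form_norm blk_inner_tail; apply: H; last by rewrite leq_add2l.
  exact: leq_trans Nm (leq_addl _ _).
move=> Hx Hy; split; first exact: HT.
apply: cvgA_unique (hinner_cvg (HT _ Hx) (HT _ Hy)) _.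
have c := cvgAB (hinner_cvg Hx Hy) (cvgA_cst (blk_inner 0 k x y)).
move=> e /c[N H]; exists N => n Nn.
rewrite blk_inner_tail addn0; have := H (k + n)%N (leq_trans Nn (leq_addl _ _)).
rewrite (_ : blk_inner 0 (k + n) x y - blk_inner 0 k x y = blk_inner k (k + n) x y)//.
rewrite (blk_inner_cat x y (leq0n k) (leq_addr n k)); ncring.
Qed.

Lemma tail_HA k x : HA A x -> HA A (seq_tail k x).
Proof. by move=> Hx; have [] := hinner_tail k Hx Hx. Qed.

Lemma tail_posA k x : HA A x ->
  posA (hinner x x - hinner (seq_tail k x) (seq_tail k x)).
Proof.
move=> Hx; have [_ ->] := hinner_tail k Hx Hx.
by rewrite opprB addrC subrK; exact: blk_inner_posA.
Qed.

Lemma seq_shift_HA k x : HA A x -> HA A (seq_shift k x).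
Proof.
move=> /HA_blkP Hx; apply/HA_blkP => e /Hx[N H]; exists (k + N)%N => m n Nm mn.
have km : (k <= m)%N by apply: leq_trans Nm; exact: leq_addr.
have -> : blk_norm m n (seq_shift k x) = blk_norm (m - k) (n - k) x.
  rewrite /blk_norm /form_norm -[in RHS](tail_shift k x) blk_inner_tail !subnKC//.
  exact: leq_trans km mn.
by apply: H; [rewrite leq_subRL|rewrite leq_sub2r].
Qed.

Lemma hinner_shift k x y : HA A x -> HA A y ->
  hinner (seq_shift k x) (seq_shift k y) = hinner x y.
Proof.
move=> Hx Hy; have [_] := hinner_tail k (seq_shift_HA (k := k) Hx)
  (seq_shift_HA (k := k) Hy); rewrite !tail_shift => ->.
rewrite /blk_inner big_nat big1 ?subr0// => i /andP[_ ik].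
by rewrite /seq_shift ik mul0r.
Qed.

Lemma bounded_op_shift k : bounded_op 1 (seq_shift k).
Proof.
split=> // [||x Hx].
- exact: seq_shift_HA.
- move=> a x y _ _; apply/funext => i; rewrite !fctE /lact /seq_shift.
  by case: ifP => // _; rewrite mulr0 addr0.
- by rewrite mul1r /hnorm hinner_shift.
Qed.

Lemma bounded_op_tail k : bounded_op 1 (seq_tail k : (nat -> A) -> nat -> A).
Proof.
split=> // [|x Hx]; first by exact: tail_HA.
rewrite mul1r -(@ler_pXn2r _ 2)// ?nnegrE ?hnorm_ge0// !hnorm_sqr.
by apply: normR_mono; [apply: hinner_posA; exact: tail_HA|exact: tail_posA].
Qed.

Lemma analysis_tail k f x : analysis (seq_tail k f) x = seq_tail k (analysis f x).
Proof. by []. Qed.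

Lemma bessel_by_tail C k f : bessel_by C f -> bessel_by C (seq_tail k f).
Proof.
move=> [C0 Hf F]; split=> // [n|x Hx]; first exact: Hf.
have [f1 f2] := F x Hx; rewrite analysis_tail; split; first exact: tail_HA.
rewrite -[X in X - _](subrK (hinner (analysis f x) (analysis f x))) -addrA.
by apply: posAD => //; exact: tail_posA.
Qed.

Lemma ebasis_HA i : HA A (ebasis A i).
Proof.
apply/HA_blkP => e e0; exists i.+1 => m n im _.
rewrite /blk_norm /form_norm /blk_inner big_nat big1 ?normR0 ?sqrtr0// => j /andP[mj _].
rewrite /ebasis gtn_eqF ?mul0r//; exact: leq_trans im mj.
Qed.

Lemma sum_fct (I : Type) (l : seq I) (F : I -> nat -> A) j :
  (\sum_(i <- l) F i) j = \sum_(i <- l) F i j.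
Proof.
elim: l => [|i l IH]; first by rewrite !big_nil.
by rewrite !big_cons !fctE IH.
Qed.

Lemma trunc_sum n x : trunc n x = \sum_(0 <= i < n) lact (x i) (ebasis A i).
Proof.
apply/funext => j; rewrite sum_fct /trunc; case: ltnP => jn.
  rewrite (bigD1_seq j) ?mem_index_iota ?iota_uniq//= big1 ?addr0.
    by rewrite /lact /ebasis eqxx mulr1.
  by move=> i ij; rewrite /lact /ebasis eq_sym (negbTE ij) mulr0.
rewrite big_nat big1// => i /andP[_ ilt]; rewrite /lact /ebasis gtn_eqF ?mulr0//.
exact: leq_trans ilt jn.
Qed.

Lemma bounded_op_comb C T n x : bounded_op C T ->
  T (trunc n x) = \sum_(0 <= i < n) lact (x i) (T (ebasis A i)).
Proof.
move=> bT; rewrite trunc_sum.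
have He i : HA A (lact (x i) (ebasis A i)) by apply: HA_lact; exact: ebasis_HA.
have [_ ->] := bounded_op_sum bT (index_iota 0 n) He.
by apply: eq_bigr => i _; rewrite (bounded_op_lact bT)//; exact: ebasis_HA.
Qed.

Lemma HA_comb (f : nat -> nat -> A) m n x : (forall i, HA A (f i)) ->
  HA A (\sum_(m <= i < n) lact (x i) (f i)).
Proof.
move=> Hf; apply: (big_ind (HA A)); [exact: HA0|by move=> u v; exact: HA_D|move=> i _].
exact: HA_lact.
Qed.

Lemma hinner_comb f m n x y : (forall i, HA A (f i)) -> HA A y ->
  hinner (\sum_(m <= i < n) lact (x i) (f i)) y = blk_inner m n x (analysis f y).
Proof.
move=> Hf Hy; rewrite /blk_inner.
suff [_ ->] : HA A (\sum_(m <= i < n) lact (x i) (f i)) /\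
  hinner (\sum_(m <= i < n) lact (x i) (f i)) y = \sum_(m <= i < n) x i * hinner (f i) y.
  by apply: eq_bigr => i _; rewrite /analysis hinner_star.
apply: (big_ind2 (fun u v => HA A u /\ hinner u y = v)).
- by split; [exact: HA0|exact: hinner0l].
- by move=> u v u' v' [Hu eu] [Hu' eu']; split; [exact: HA_D|rewrite hinnerDl// eu eu'].
- by move=> i _; split; [exact: HA_lact|rewrite hinner_lactl].
Qed.

Lemma hinner_hcvg u x y : (forall n, HA A (u n)) -> HA A x -> HA A y -> hcvg u x ->
  cvgA (fun n => hinner (u n) y) (hinner x y).
Proof.
move=> Hu Hx Hy ux e e0; have Y1 : 0 < hnorm y + 1 by rewrite ltr_wpDl ?hnorm_ge0.
have d0 : 0 < e / (hnorm y + 1) by rewrite divr_gt0.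
have [N H] := ux _ d0; exists N => n /H; rewrite ltr_pdivlMr// => h.
have -> : hinner (u n) y - hinner x y = hinner (u n - x) y.
  by rewrite hinnerDl ?hinnerNl//; exact: HA_N.
apply: le_lt_trans (hinner_CS (HA_B (Hu n) Hx) Hy) _.
by have := hnorm_ge0 (u n - x); have := hnorm_ge0 y; nra.
Qed.

(** Both sides are continuous in x and agree on finite combinations of the
    standard basis. *)
Lemma adjoint C T f x y : bounded_op C T -> (forall i, T (ebasis A i) = f i) ->
  (forall z, HA A z -> HA A (analysis f z)) ->
  HA A x -> HA A y -> hinner (T x) y = hinner x (analysis f y).
Proof.
move=> bT Tf HF Hx Hy; have [Ht tx] := trunc_cvg Hx.
have c1 := hinner_hcvg (fun n => bounded_op_HA bT (Ht n)) (bounded_op_HA bT Hx) Hy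
  (bounded_op_hcvg bT Ht Hx tx).
apply: cvgA_unique c1 _; under eq_fun => n.
  rewrite /= (bounded_op_comb _ _ bT); under eq_bigr do rewrite Tf.
  rewrite hinner_comb//; last by move=> i; rewrite -Tf; apply: bounded_op_HA bT _ _; exact: ebasis_HA.
  over.
by apply: hinner_cvg => //; exact: HF.
Qed.

(** For z the combination, <z, z> is the block inner product of x with the
    analysis sequence of z, whose norm is at most sqrt C |z|. *)
Lemma comb_le C f m n x : bessel_by C f ->
  hnorm (\sum_(m <= i < n) lact (x i) (f i)) <= Num.sqrt C * blk_norm m n x.
Proof.
move=> bf; have [C0 Hf F] := bf; set z := \sum_(_ <= i < _) _.
have Hz : HA A z by exact: HA_comb.
have h : hnorm z ^+ 2 <= blk_norm m n x * (Num.sqrt C * hnorm z).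
  rewrite hnorm_sqr {1}/z hinner_comb//; apply: le_trans (blk_inner_CS _ _ _ _) _.
  rewrite ler_wpM2l ?blk_norm_ge0//; apply: le_trans (bounded_op_le (bessel_by_analysis bf) Hz).
  by apply: blk_norm_le_hnorm; exact: (bounded_op_HA (bessel_by_analysis bf)).
have [z0|z0] := eqVneq (hnorm z) 0; first by rewrite z0 mulr_ge0 ?sqrtr_ge0 ?blk_norm_ge0.
have zp : 0 < hnorm z by rewrite lt_neqAle eq_sym z0 hnorm_ge0.
by rewrite -(ler_pM2r zp) -expr2 mulrAC mulrC.
Qed.

Lemma hnorm_hcvg_le u x C : (forall n, HA A (u n)) -> HA A x -> hcvg u x ->
  (exists N, forall n, (N <= n)%N -> hnorm (u n) <= C) -> hnorm x <= C.
Proof.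
move=> Hu Hx ux [N H]; apply/ler_addgt0Pr => e e0; have [N' H'] := ux _ e0.
have h := H _ (leq_maxl N N'); have h' := H' _ (leq_maxr N N').
have := hnormD (Hu (maxn N N')) (HA_B Hx (Hu (maxn N N'))).
rewrite addrC subrK; rewrite hnormBC in h'; lra.
Qed.

Lemma hcvg_lin a u v x y : (forall n, HA A (u n)) -> (forall n, HA A (v n)) ->
  HA A x -> HA A y -> hcvg u x -> hcvg v y ->
  hcvg (fun n => lact a (u n) + v n) (lact a x + y).
Proof.
move=> Hu Hv Hx Hy c1 c2 e e0.
have a1 : 0 < normR a + 1 by rewrite ltr_wpDl ?normR_ge0.
have e2 : 0 < e / 2 by rewrite divr_gt0.
have d0 : 0 < e / 2 / (normR a + 1) by rewrite divr_gt0.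
have [N HN] := c1 _ d0; have [N' HN'] := c2 _ e2.
exists (maxn N N') => n; rewrite geq_max => /andP[/HN h /HN' h'].
have -> : lact a (u n) + v n - (lact a x + y) = lact a (u n - x) + (v n - y).
  by rewrite lactDr opprD addrACA -[in RHS]lactN1 lactA -!lactN1 lactA mulrN1 mulN1r.
have Hd := HA_B (Hu n) Hx; have Hd' := HA_B (Hv n) Hy.
apply: le_lt_trans (hnormD (HA_lact (a := a) Hd) Hd') _.
have := hnorm_lact a Hd; move: h; rewrite ltr_pdivlMr// => h.
by have := hnorm_ge0 (u n - x); have := normR_ge0 a; nra.
Qed.

Lemma synthesis C f : bessel_by C f -> exists T, bounded_op (Num.sqrt C) T /\
  forall i, T (ebasis A i) = f i.
Proof.
move=> bf; have [C0 Hf F] := bf.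
pose S n x := \sum_(0 <= i < n) lact (x i) (f i).
have HS n x : HA A (S n x) by exact: HA_comb.
have SS m n x : (m <= n)%N -> S n x - S m x = \sum_(m <= i < n) lact (x i) (f i).
  move=> mn; rewrite /S (big_cat_nat (leq0n m) mn)/=.
  by move: (\sum_(0 <= i < m) _) (\sum_(m <= i < n) _) => u v; seqring.
have ex x : HA A x -> exists y, HA A y /\ hcvg (S^~ x) y.
  move=> Hx; apply: HA_complete => // e e0.
  have C1 : 0 < Num.sqrt C + 1 by rewrite ltr_wpDl ?sqrtr_ge0.
  have d0 : 0 < e / (Num.sqrt C + 1) by rewrite divr_gt0.
  have /HA_blkP/(_ _ d0)[N H] := Hx; exists N => m n Nm mn; rewrite SS//.
  apply: le_lt_trans (comb_le _ _ _ bf) _; have := H m n Nm mn; rewrite ltr_pdivlMr//.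
  by have := blk_norm_ge0 m n x; have := sqrtr_ge0 C; nra.
have [T TP] := choice_on (0 : nat -> A) ex.
exists T; split; first split.
- exact: sqrtr_ge0.
- by move=> x /TP[].
- move=> a x y Hx Hy; have [H1 c1] := TP _ Hx; have [H2 c2] := TP _ Hy.
  have [H3 c3] := TP _ (HA_D (HA_lact (a := a) Hx) Hy).
  have H4 : HA A (lact a (T x) + T y) by apply: HA_D => //; exact: HA_lact.
  apply: hcvg_unique c3 _ => //.
  have -> : S^~ (lact a x + y) = fun n => lact a (S n x) + S n y.
    apply/funext => n; rewrite /S; elim: n => [|n IH].
      by rewrite !big_geq// lactr0 addr0.
    rewrite !big_nat_recr//= IH lactDr addrACA; congr (_ + _).
    by rewrite lactA -lactD.
  exact: hcvg_lin.
- move=> x Hx; have [H1 c1] := TP _ Hx; apply: hnorm_hcvg_le c1 _ => //.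
  exists 0%N => n _; apply: le_trans (comb_le _ _ _ bf) _.
  by rewrite ler_wpM2l ?sqrtr_ge0// blk_norm_le_hnorm.
- move=> i; have [H1 c1] := TP _ (ebasis_HA (i := i)); apply: hcvg_unique c1 _ => // e e0.
  exists i.+1 => n ilt; suff -> : S n (ebasis A i) = f i by rewrite subrr hnorm0.
  rewrite /S (bigD1_seq i) ?mem_index_iota ?iota_uniq//= big1 ?addr0.
    by rewrite /ebasis eqxx lact1.
  by move=> j ji; rewrite /ebasis (negbTE ji) lact0.
Qed.

(** From norms to the order of A: for e > 0 and h the inverse square root of
    <T x, T x> + e, the vector T (h x) has norm at most 1; then h <x, x> h <= C^2,
    which is the claim up to e after multiplying by h^-1 on both sides. *)
Lemma paschke C D T : bounded_op D T -> (forall x, HA A x -> hnorm x <= C * hnorm (T x)) ->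
  0 <= C -> forall x, HA A x ->
  posA (realA A (C ^+ 2) * hinner (T x) (T x) - hinner x x).
Proof.
move=> bT below C0 x Hx; set p := hinner (T x) (T x); set q := hinner x x.
have HT := bounded_op_HA bT Hx; have pp : posA p := hinner_posA HT; have posq : posA q := hinner_posA Hx.
have main e : 0 < e -> posA (realA A (C ^+ 2) * (p + realA A e) - q).
  move=> e0; have [h [k [sh_ sk hk kh kk]]] := inv_sqrt pp e0.
  have Eh : h * p * h = 1 - realA A e * (h * h).
    have -> : p = k * k - realA A e by rewrite kk addrK.
    rewrite mulrBr mulrBl !mulrA hk mul1r kh; congr (_ - _).
    by rewrite realAC.
  have h1 : normR (h * p * h) <= 1.
    rewrite -(normR1 A); apply: normR_mono; first by rewrite -{2}sh_; exact: posA_conj.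
    by rewrite Eh opprB addrC subrK; apply: posAZ; [exact: ltW|exact: posA_sqr].
  have h2 : normR (h * q * h) <= C ^+ 2.
    have e1 : hinner (lact h x) (lact h x) = h * q * h.
      by rewrite hinner_lactl ?hinner_lactr ?sh_ ?mulrA//; exact: HA_lact.
    have e2 : hinner (T (lact h x)) (T (lact h x)) = h * p * h.
      by rewrite (bounded_op_lact bT)// hinner_lactl ?hinner_lactr ?sh_ ?mulrA//; exact: HA_lact.
    rewrite -e1 -hnorm_sqr -[X in _ <= X]mulr1; have := below _ (HA_lact (a := h) Hx).
    have : hnorm (T (lact h x)) <= 1.
      by rewrite -(@ler_pXn2r _ 2)// ?nnegrE ?hnorm_ge0// hnorm_sqr e2 expr1n.
    move=> T1 /le_trans h3; rewrite mulr1 ler_pXn2r ?nnegrE ?hnorm_ge0//; apply: h3.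
    by rewrite -[X in _ <= X]mulr1 ler_wpM2l.
  have : posA (realA A (C ^+ 2) - h * q * h).
    apply: posA_realAB => //; rewrite -{2}sh_; apply: posA_selfadj; exact: posA_conj.
  move=> /(posA_conj k); rewrite sk mulrBr mulrBl realAC -[realA A _ * k * k]mulrA kk.
  have -> // : k * (h * q * h) * k = q by rewrite -!mulrA hk mulr1 mulrA kh mul1r.
apply: posA_closed.
  by apply: selfadjB; [apply: selfadj_realAM|]; exact: posA_selfadj.
move=> e e0; have C1 : 0 < C ^+ 2 + 1 by rewrite ltr_wpDl ?exprn_ge0.
pose d := e / (C ^+ 2 + 1); have d0 : 0 < d by rewrite divr_gt0.
have := main d d0; rewrite mulrDr -realAM.
have -> : realA A (C ^+ 2) * p - q + realA A e =
  (realA A (C ^+ 2) * p + realA A (C ^+ 2 * d) - q) + realA A (e - C ^+ 2 * d).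
  rewrite realAB; ncring.
move=> h; apply: posAD => //; apply: posA_realA.
have -> : e - C ^+ 2 * d = d by rewrite /d; field; rewrite gt_eqF.
exact: ltW.
Qed.

(** T^* T is invertible because 1 - t T^* T, with t = 1 / C, is a strict
    contraction: <T^* T x, T^* T x> <= C <T x, T x> by the Bessel bound, so that the
    inner square of x - t T^* T x is at most
    <x, x> - t <T x, T x> <= (1 - t / E^2) <x, x>. *)
Lemma right_inverse C D E T f : bessel_by C f -> 0 < C -> bounded_op D T ->
  (forall i, T (ebasis A i) = f i) ->
  0 < E -> (forall x, HA A x -> hnorm x <= E * hnorm (T x)) ->
  exists S R', bounded_op R' S /\ forall y, HA A y -> analysis f (S y) = y.
Proof.
move=> bf C0 bT Tf E0 below; have [_ Hf F] := bf.
pose t := C^-1; have t0 : 0 < t by rewrite invr_gt0.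
(* Increasing E keeps the contraction factor 1 - t / E^2 nonnegative. *)
wlog tE : E E0 below / t <= E ^+ 2.
  move=> H; have E1 : 1 <= E + t + 1 by have := ltW t0; have := ltW E0; lra.
  apply: (H (E + t + 1)); first by apply: lt_le_trans E1.
  - move=> x Hx; apply: le_trans (below x Hx) _; rewrite ler_wpM2r ?hnorm_ge0//.
    by have := ltW t0; lra.
  - by have := ltW t0; have := ltW E0; nra.
have bB := bounded_op_comp (bessel_by_analysis bf) bT.
have bK0 := bounded_op_add (bounded_op_comp (bounded_op_scale A t) bB) (bounded_op_opp (bounded_op_id A)).
pose K x := lact (realA A t) (analysis f (T x)) + - x.
pose q2 := 1 - t / E ^+ 2.
have q20 : 0 <= q2 by rewrite subr_ge0 ler_pdivrMr ?exprn_gt0// mul1r.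
have Kle x : HA A x -> hnorm (K x) ^+ 2 <= q2 * hnorm x ^+ 2.
  move=> Hx; have HT := bounded_op_HA bT Hx; have [HB pB] := F _ HT.
  set Bx := analysis f (T x) in HB pB *.
  have xB : hinner x Bx = hinner (T x) (T x).
    by rewrite (adjoint bT Tf)// => z /F[].
  have Bxx : hinner Bx x = hinner (T x) (T x).
    by rewrite -(hinner_star Hx HB) xB hinner_star.
  have E1 : hinner (K x) (K x) = realA A (t * t) * hinner Bx Bx -
      realA A (2 * t) * hinner (T x) (T x) + hinner x x.
    have HtB := HA_lact (a := realA A t) HB; have HN := HA_N Hx.
    rewrite hinner_sqrD// !hinnerNr// !hinnerNl// hinner_lactl// !hinner_lactr//.
    rewrite hinner_lactl// selfadj_realA !realAC realAMA xB Bxx opprK mulr_natl mulr2n realAD; ncring.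
  have key : posA (realA A q2 * hinner x x - hinner (K x) (K x)).
    have P1 := posAZ (mulr_ge0 (ltW t0) (ltW t0)) pB.
    have E2i : 0 <= t / E ^+ 2 by rewrite divr_ge0 ?exprn_ge0 ?(ltW t0) ?(ltW E0).
    have P2 := posAZ E2i (paschke bT below (ltW E0) Hx).
    have := posAD P1 P2; rewrite E1 !mulrBr !realAMA.
    have -> : t * t * C = t by rewrite /t; field; rewrite gt_eqF.
    have -> : t / E ^+ 2 * E ^+ 2 = t by rewrite divfK// gt_eqF ?exprn_gt0.
    rewrite /q2 realAB realA1 mulr_natl mulr2n realAD.
    congr posA; ncring.
  rewrite !hnorm_sqr; have := normR_mono (hinner_posA (bounded_op_HA bK0 Hx)) key.
  by rewrite normR_realAM ger0_norm.
have bK : bounded_op (Num.sqrt q2) K.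
  case: bK0 => _ K1 K2 _; split=> // x Hx.
  rewrite -(@ler_pXn2r _ 2)// ?nnegrE ?mulr_ge0 ?sqrtr_ge0 ?hnorm_ge0//.
  by rewrite exprMn [Num.sqrt q2 ^+ 2]sqr_sqrtr//; exact: Kle.
have [S [bS S1 _]] : exists S, [/\ bounded_op (1 - Num.sqrt q2)^-1 S,
  forall y, HA A y -> S y + K (S y) = y & forall x, HA A x -> S (x + K x) = x].
  apply: neumann bK _; rewrite -(sqrtr1 R) ltr_sqrt// /q2 gtrDl oppr_lt0.
  by rewrite divr_gt0 ?exprn_gt0.
exists (fun y => T (lact (realA A t) (S y))); eexists; split.
  by apply: bounded_op_comp bT _; apply: bounded_op_comp (bounded_op_scale A t) bS.
move=> y Hy; rewrite -[RHS](S1 y Hy) /K addrC subrK.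
have HS := bounded_op_HA bS Hy; have HTS := bounded_op_HA bT HS.
by rewrite (bounded_op_lact bT)// (bounded_op_lact (bessel_by_analysis bf)).
Qed.

End Bessel.

(** * Riesz bases and orthogonal complements *)

Section Riesz.
Context (R : realType) (A : cstarAlgType R).
Implicit Types (a b c : A) (x y z : nat -> A) (r s t e C D E : R)
  (T K W : (nat -> A) -> nat -> A) (f g F : nat -> nat -> A) (X Y Z : set (nat -> A)).

Lemma analysis_comb0 F y m (c : 'I_m -> A) : (forall n, HA A (F n)) -> HA A y ->
  analysis F y = 0 -> hinner (\sum_(j < m) lact (c j) (F j)) y = 0.
Proof.
move=> HF Hy y0.
suff [] : HA A (\sum_(j < m) lact (c j) (F j)) /\
   hinner (\sum_(j < m) lact (c j) (F j)) y = 0 by [].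
apply: (big_ind (fun u => HA A u /\ hinner u y = 0)).
- by split; [exact: HA0|exact: hinner0l].
- by move=> u v [Hu eu] [Hv ev]; split; [exact: HA_D|rewrite hinnerDl// eu ev addr0].
- move=> j _; split; first exact: HA_lact.
  rewrite hinner_lactl// -hinner_star//.
  by have /(congr1 (@^~ (j : nat))) := y0; rewrite /analysis => ->; rewrite star0 mulr0.
Qed.

Lemma span_HA F y : (forall n, HA A (F n)) -> Aspan F y -> HA A y.
Proof.
move=> HF [m [c ->]]; apply: (big_ind (HA A)); [exact: HA0|by move=> u v; exact: HA_D|].
by move=> j _; exact: HA_lact.
Qed.

Lemma span_single F i : Aspan F (F i).
Proof.
exists i.+1, (fun j => if j == ord_max then 1 else 0).
rewrite (bigD1 ord_max)//= eqxx lact1 big1 ?addr0// => j /negbTE->.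
by rewrite lact0.
Qed.

Lemma closure_incl X x : X `<=` HA A -> X x -> hclosure X x.
Proof.
move=> XH Xx; split; first exact: XH.
by move=> e e0; exists x => //; rewrite subrr hnorm0.
Qed.

(** By [orth_span], the orthogonal complement of the closed span of F. *)
Definition ker_analysis F : set (nat -> A) := [set y | HA A y /\ analysis F y = 0].

Lemma orth_span F : (forall n, HA A (F n)) -> orth (hclosure (Aspan F)) = ker_analysis F.
Proof.
move=> HF; apply/seteqP; split=> y [Hy yF]; split=> //.
  apply/funext => i; apply: yF; apply: closure_incl; last exact: span_single.
  by move=> z; exact: span_HA.
move=> z [Hz zF]; apply: normR_eq0; apply/eqP; rewrite eq_le normR_ge0 andbT.
apply/ler_addgt0Pr => e e0; rewrite add0r.
have Y1 : 0 < hnorm y + 1 by rewrite ltr_wpDl ?hnorm_ge0.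
have d0 : 0 < e / (hnorm y + 1) by rewrite divr_gt0.
have [w Fw] := zF _ d0; rewrite ltr_pdivlMr// => h.
have Hw := span_HA HF Fw.
have w0 : hinner y w = 0.
  rewrite -hinner_star//; case: Fw => m [c ->].
  by rewrite analysis_comb0 ?star0.
have -> : hinner y z = hinner y (z - w) by rewrite hinnerDr ?hinnerNr// ?w0 ?subr0//; exact: HA_N.
apply: le_trans (hinner_CS Hy (HA_B Hz Hw)) _.
by have := hnorm_ge0 (z - w); have := hnorm_ge0 y; nra.
Qed.

(** The range of T lies in the closed span by truncating x, and contains it
    because preimages of a Cauchy sequence form a Cauchy sequence. *)
Lemma riesz_of_below C D E T F : bessel_by C F -> bounded_op D T ->
  (forall i, T (ebasis A i) = F i) -> 0 <= E ->
  (forall x, HA A x -> hnorm x <= E * hnorm (T x)) ->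
  modular_riesz_basis (hclosure (Aspan F)) F.
Proof.
move=> bF bT TF E0 below; have [C0 HF FA] := bF.
have inj x y : HA A x -> HA A y -> T x = T y -> x = y.
  move=> Hx Hy e; apply/eqP; rewrite -subr_eq0; apply/eqP.
  apply: hnorm_eq0; first exact: HA_B.
  have := below _ (HA_B Hx Hy); rewrite (bounded_op_B bT)// e subrr hnorm0 mulr0 => h.
  by apply/eqP; rewrite eq_le h hnorm_ge0.
have TX x : HA A x -> hclosure (Aspan F) (T x).
  move=> Hx; split; first exact: bounded_op_HA bT _ Hx.
  move=> e e0; have [Ht tx] := trunc_cvg Hx.
  have [N H] := bounded_op_hcvg bT Ht Hx tx e0.
  exists (T (trunc N x)); last by rewrite hnormBC; exact: H.
  exists N, (fun j => x j); rewrite (bounded_op_comb _ _ bT) big_mkord.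
  by apply: eq_bigr => j _; rewrite TF.
have surj y : hclosure (Aspan F) y -> exists x, HA A x /\ T x = y.
  move=> [Hy yF].
  have pre e : 0 < e -> exists x, HA A x /\ hnorm (T x - y) < e.
    move=> /yF[_ [m [c ->]]]; rewrite hnormBC => h.
    have He (j : 'I_m) : HA A (lact (c j) (ebasis A j)).
      by apply: HA_lact; exact: ebasis_HA.
    have [H1 H2] := bounded_op_sum bT (index_enum 'I_m) He.
    exists (\sum_(j < m) lact (c j) (ebasis A j)); split=> //; rewrite H2.
    rewrite (eq_bigr (fun j : 'I_m => lact (c j) (F j))) // => j _.
    by rewrite (bounded_op_lact bT) ?TF//; exact: ebasis_HA.
  have pren (n : nat) : setT n -> exists x, HA A x /\ hnorm (T x - y) < n.+1%:R^-1.
    by move=> _; apply: pre; rewrite invr_gt0.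
  have [u uP] := choice_on (0 : nat -> A) pren.
  have Hu n : HA A (u n) by have [] := uP n I.
  have cTu : hcvg (T \o u) y.
    move=> e e0; have [N _ H] := near_infty_natSinv_lt (PosNum e0).
    exists N => n Nn; have [_ h] := uP n I; exact: lt_trans h (H n Nn).
  have [x [Hx ux]] : exists x, HA A x /\ hcvg u x.
    apply: HA_complete => // e e0.
    have E1 : 0 < E + 1 by rewrite ltr_wpDl.
    have d0 : 0 < e / (E + 1) / 2 by rewrite !divr_gt0.
    have [N H] := cTu _ d0; exists N => m n Nm mn.
    have := below _ (HA_B (Hu n) (Hu m)); rewrite (bounded_op_B bT)// => h.
    have := hnorm_triangle (bounded_op_HA bT (Hu n)) Hy (bounded_op_HA bT (Hu m)).
    have := H n (leq_trans Nm mn); have := H m Nm; rewrite /= [hnorm (y - _)]hnormBC.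
    set d := e / (E + 1) / 2 => h1 h2 h3.
    have de : e = d * 2 * (E + 1) by rewrite /d divfK ?pnatr_eq0// divfK// gt_eqF.
    by rewrite de; have := hnorm_ge0 (T (u n) - T (u m)); nra.
  exists x; split=> //; apply: (@hcvg_unique _ _ (T \o u)) => //.
  - by move=> n; exact: (bounded_op_HA bT).
  - exact: bounded_op_HA bT _ Hx.
  - by move=> e /(bounded_op_hcvg bT Hu Hx ux)[N H]; exists N => n /H.
have [S SP] := choice_on (0 : nat -> A) surj.
exists T; split=> //.
- split.
    split=> //; first by move=> a x y Hx Hy; exact: bounded_op_lin bT _ _ _ Hx Hy.
    by exists D => x Hx; exact: bounded_op_le.
  exists S; split.
  + split.
    * by move=> y /SP[].
    * move=> a x y Xx Xy; have [H1 E1] := SP _ Xx; have [H2 E2] := SP _ Xy.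
      have H12 : HA A (lact a (S x) + S y) by apply: HA_D => //; exact: HA_lact.
      have ET : T (lact a (S x) + S y) = lact a x + y by rewrite (bounded_op_lin bT)// E1 E2.
      have [H3 E3] := SP (lact a x + y) (eq_ind _ _ (TX _ H12) _ ET).
      by apply: inj => //; rewrite E3 ET.
    * by exists E => y /SP[H1 E1]; rewrite -{2}E1; exact: below.
  + move=> x Hx; have [H1 E1] := SP _ (TX _ Hx); exact: inj.
  + by move=> y /SP[].
- exists (analysis F); split=> [y [Hy _]|x y Hx [Hy _]]; first by have [] := FA y Hy.
  by apply: (adjoint bT TF) => // z /FA[].
Qed.

(** * Closed submodules and their isomorphisms *)

Lemma closed_preimage C W Z : bounded_op C W -> closed_submodule Z ->
  closed_submodule [set y | HA A y /\ Z (W y)].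
Proof.
move=> bW [ZH Z0 ZL Zc]; split.
- by move=> y [].
- by split; [exact: HA0|rewrite (bounded_op0 bW)].
- move=> a x y [Hx Wx] [Hy Wy]; split; last by rewrite (bounded_op_lin bW)//; exact: ZL.
  by apply: HA_D => //; exact: HA_lact.
- move=> y [Hy yc]; split=> //; apply: Zc; split; first exact: bounded_op_HA bW _ Hy.
  move=> e e0; have C1 : 0 < C + 1 by rewrite ltr_wpDl ?(bounded_op_ge0 bW).
  have d0 : 0 < e / (C + 1) by rewrite divr_gt0.
  have [z [Hz Wz]] := yc _ d0; rewrite ltr_pdivlMr// => h.
  exists (W z) => //; rewrite -(bounded_op_B bW)//.
  apply: le_lt_trans (bounded_op_le bW (HA_B Hy Hz)) _.
  by have := hnorm_ge0 (y - z); have := bounded_op_ge0 bW; nra.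
Qed.

Lemma closed_inter X Z : closed_submodule X -> closed_submodule Z ->
  closed_submodule (X `&` Z).
Proof.
move=> [XH X0 XL Xc] [ZH Z0 ZL Zc]; split.
- by move=> y [/XH].
- by [].
- by move=> a x y [Xx Zx] [Xy Zy]; split; [exact: XL|exact: ZL].
- move=> y [Hy yc]; split; [apply: Xc|apply: Zc]; split=> // e /yc[z [Xz Zz] h];
    by exists z.
Qed.

Lemma closed_zero : closed_submodule ([set 0] : set (nat -> A)).
Proof.
split.
- by move=> _ ->; exact: HA0.
- by [].
- by move=> a _ _ -> ->; rewrite lactr0 addr0.
- move=> y [Hy yc]; apply: hnorm_eq0 => //; apply/eqP; rewrite eq_le hnorm_ge0 andbT.
  apply/ler_addgt0Pr => e /yc[_ ->]; rewrite subr0 add0r; exact: ltW.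
Qed.

Lemma closed_ker_analysis C F : bessel_by C F -> closed_submodule (ker_analysis F).
Proof. by move=> bF; exact: closed_preimage (bessel_by_analysis bF) closed_zero. Qed.

Lemma bounded_comp X Y Z T K : bounded_Amap X Y T -> bounded_Amap Y Z K ->
  bounded_Amap X Z (K \o T).
Proof.
move=> [TX Tl [C TC]] [KY Kl [D KD]]; split=> [x Xx|a x y Xx Xy|] /=.
- exact/KY/TX.
- by rewrite Tl// Kl//; exact: TX.
- exists (`|D| * `|C|) => x Xx; apply: le_trans (KD _ (TX _ Xx)) _.
  have h1 : D * hnorm (T x) <= `|D| * hnorm (T x).
    by rewrite ler_wpM2r ?hnorm_ge0 ?ler_norm.
  apply: le_trans h1 _; rewrite -mulrA ler_wpM2l//.
  by apply: le_trans (TC _ Xx) _; rewrite ler_wpM2r ?hnorm_ge0 ?ler_norm.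
Qed.

Lemma bounded_add X T K : bounded_Amap X (HA A) T -> bounded_Amap X (HA A) K ->
  bounded_Amap X (HA A) (fun x => T x + K x).
Proof.
move=> [TX Tl [C TC]] [KX Kl [D KD]]; split=> [x Xx|a x y Xx Xy|].
- by apply: HA_D; [exact: TX|exact: KX].
- by rewrite Tl// Kl// lactDr addrACA.
- exists (C + D) => x Xx; apply: le_trans (hnormD (TX _ Xx) (KX _ Xx)) _.
  by rewrite mulrDl; have := TC x Xx; have := KD x Xx; lra.
Qed.

Lemma bounded_codom X Y Z T : bounded_Amap X Y T -> (forall x, X x -> Z (T x)) ->
  bounded_Amap X Z T.
Proof. by move=> [_ Tl TC] TZ; split. Qed.

Lemma bounded_dom X Y Z T : bounded_Amap X Y T -> Z `<=` X -> bounded_Amap Z Y T.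
Proof.
move=> [TX Tl [C TC]] ZX; split=> [x /ZX/TX//|a x y /ZX Xx /ZX Xy|]; first exact: Tl.
by exists C => x /ZX/TC.
Qed.

Lemma bounded_op_bounded C T : bounded_op C T -> bounded_Amap (HA A) (HA A) T.
Proof.
move=> bT; split; [exact: bounded_op_HA bT|by move=> a x y; exact: (bounded_op_lin bT)|].
by exists C => x; exact: (bounded_op_le bT).
Qed.

Lemma hiso_trans X Y Z : hiso X Y -> hiso Y Z -> hiso X Z.
Proof.
move=> [T [bT [T' [bT' TT' T'T]]]] [K [bK [K' [bK' KK' K'K]]]].
exists (K \o T); split; first exact: bounded_comp bT bK.
exists (T' \o K'); split; first exact: bounded_comp bK' bT'.
- by move=> x Xx /=; rewrite KK' ?TT'//; case: bT => + _ _; apply.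
- by move=> z Zz /=; rewrite T'T ?K'K//; case: bK' => + _ _; apply.
Qed.

Lemma hiso_preimage C D W K Z : bounded_op C W -> bounded_op D K ->
  (forall y, HA A y -> W (K y) = y) -> (forall y, HA A y -> K (W y) = y) ->
  Z `<=` HA A -> hiso Z [set y | HA A y /\ Z (W y)].
Proof.
move=> bW bK WK KW ZH; exists K; split.
  apply: bounded_codom (bounded_dom (bounded_op_bounded bK) ZH) _ => x Zx.
  by split; [apply: bounded_op_HA bK _ _; exact: ZH|rewrite WK//; exact: ZH].
exists W; split.
- have sub : [set y | HA A y /\ Z (W y)] `<=` HA A by move=> y [].
  by apply: bounded_codom (bounded_dom (bounded_op_bounded bW) sub) _ => y [].
- by move=> x /ZH; exact: WK.
- by move=> y [Hy _]; exact: KW.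
Qed.

Lemma truncE k x : trunc k x = x - seq_shift k (seq_tail k x).
Proof.
apply/funext => i; rewrite !fctE /trunc /seq_shift /seq_tail; case: ltnP => ik.
  by rewrite subr0.
by rewrite subnKC// subrr.
Qed.

Lemma bounded_op_trunc k : bounded_op (1 + 1 * 1) (trunc k : (nat -> A) -> nat -> A).
Proof.
have -> : trunc k = fun x : nat -> A => x + - seq_shift k (seq_tail k x).
  by apply/funext => x; rewrite truncE.
exact: bounded_op_add (bounded_op_id A)
  (bounded_op_opp (bounded_op_comp (bounded_op_shift A k) (bounded_op_tail A k))).
Qed.

Lemma Lsub_trunc k x : HA A x -> Lsub A k (trunc k x).
Proof.
move=> Hx; split; first exact: bounded_op_HA (bounded_op_trunc k) _ Hx.
by move=> i ki; rewrite /trunc ltnNge ki.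
Qed.

Lemma trunc_Lsub k x : Lsub A k x -> trunc k x = x.
Proof. by move=> [_ x0]; apply/funext => i; rewrite /trunc; case: ltnP => // /x0. Qed.

Lemma tail_Lsub k x : Lsub A k x -> seq_tail k x = 0.
Proof. by move=> [_ x0]; apply/funext => i; rewrite /seq_tail x0// leq_addr. Qed.

Lemma Lsub_HA k : Lsub A k `<=` HA A. Proof. by move=> x []. Qed.

Lemma seq_tail_add k d (S : Type) (F : nat -> S) :
  seq_tail d (seq_tail k F) = seq_tail (k + d) F.
Proof. by apply/funext => i; rewrite /seq_tail addnA. Qed.

(** y = (y - S (C_F y)) + S (C_F y) splits the complement of the tail into the
    complement ker C_F and S(L_d).  The isomorphism uses the given one on the
    first k coordinates and S on the d next ones.  Keeping a submodule Z of
    ker C_F general covers at once the embedding of L_k into ker C_F and the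
    isomorphism between the two, where Z = ker C_F. *)
Lemma hiso_shift C D k d F S Z : bessel_by C F -> bounded_op D S ->
  (forall y, HA A y -> analysis F (S y) = y) -> Z `<=` ker_analysis F -> hiso (Lsub A k) Z ->
  hiso (Lsub A (k + d))
    (ker_analysis (seq_tail d F) `&` [set y | HA A y /\ Z (y - S (analysis F y))]).
Proof.
move=> bF bS FS ZF [U [bU [U' [bU' UU' U'U]]]].
have bA := bessel_by_analysis bF; set N := _ `&` _.
have ZH : Z `<=` HA A by move=> z /ZF[].
have NH : N `<=` HA A by move=> y [[]].
have [UZ _ _] := bU; have [U'L _ _] := bU'.
exists (fun x => U (trunc k x) + S (seq_tail k x)); split.
  apply: bounded_codom.
    apply: bounded_add.
      have b1 := bounded_dom (bounded_op_bounded (bounded_op_trunc k)) (@Lsub_HA (k + d)).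
      have b2 := bounded_codom b1 (fun x Lx => Lsub_trunc k (Lsub_HA Lx)).
      have b3 := bounded_comp b2 bU.
      by apply: bounded_codom b3 _ => x Lx; apply/ZH/UZ/Lsub_trunc/Lsub_HA/Lx.
    have b1 := bounded_op_bounded (bounded_op_comp bS (bounded_op_tail A k)).
    exact: bounded_dom b1 (@Lsub_HA (k + d)).
  move=> x Lx; have Hx := Lsub_HA Lx.
  have Ztx := UZ _ (Lsub_trunc k Hx); have [Hu u0] := ZF _ Ztx.
  have Ht := tail_HA (k := k) Hx; have Hs := bounded_op_HA bS Ht.
  have aE : analysis F (U (trunc k x) + S (seq_tail k x)) = seq_tail k x.
    by rewrite (bounded_op_D bA)// u0 add0r FS.
  split; split; try exact: HA_D.
    by rewrite analysis_tail aE seq_tail_add tail_Lsub.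
  by rewrite aE addrK.
exists (fun y => U' (y - S (analysis F y)) + seq_shift k (analysis F y)); split.
- have bP := bounded_op_add (bounded_op_id A) (bounded_op_opp (bounded_op_comp bS bA)).
  apply: bounded_codom.
    apply: bounded_add.
      have b1 := bounded_dom (bounded_op_bounded bP) NH.
      have b2 : bounded_Amap N Z (fun y => y + - S (analysis F y)).
        by apply: bounded_codom b1 _ => y [_ []].
      have b3 := bounded_comp b2 bU'.
      by apply: bounded_codom b3 _ => y [_ [_ Zy]]; apply/Lsub_HA/U'L/Zy.
    exact: bounded_dom (bounded_op_bounded (bounded_op_comp (bounded_op_shift A k) bA)) NH.
  move=> y [[Hy y0] [_ Zy]]; have [Hu u0] := U'L _ Zy.
  have Ha := bounded_op_HA bA Hy.
  split; first by apply: HA_D => //; exact: seq_shift_HA.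
  move=> i kdi; rewrite !fctE u0 ?(leq_trans (leq_addr d k))// add0r /seq_shift.
  rewrite ltnNge (leq_trans (leq_addr d k))//=.
  have /(congr1 (@^~ (i - k - d)%N)) := y0; rewrite analysis_tail /seq_tail subnKC//.
  by rewrite leq_subRL// (leq_trans (leq_addr d k)).
- move=> x Lx; have Hx := Lsub_HA Lx.
  have Ztx := UZ _ (Lsub_trunc k Hx); have [Hu u0] := ZF _ Ztx.
  have Ht := tail_HA (k := k) Hx; have Hs := bounded_op_HA bS Ht.
  have aE : analysis F (U (trunc k x) + S (seq_tail k x)) = seq_tail k x.
    by rewrite (bounded_op_D bA)// u0 add0r FS.
  rewrite aE addrK UU'; last exact: Lsub_trunc.
  by rewrite truncE subrK.
- move=> y [[Hy y0] [_ Zy]]; have Lu := U'L _ Zy; have Ha := bounded_op_HA bA Hy.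
  have Hu := Lsub_HA Lu; have Hsh := seq_shift_HA (k := k) Ha.
  rewrite (bounded_op_D (bounded_op_trunc k))// trunc_Lsub// truncE tail_shift subrr addr0 U'U//.
  by rewrite (bounded_op_D (bounded_op_tail A k))// tail_Lsub// add0r tail_shift subrK.
Qed.


End Riesz.

(** * Stability of the tails *)

Section Assembly.
Context (R : realType) (A : cstarAlgType R).
Implicit Types (a b c : A) (x y z : nat -> A) (r s t e C D E : R)
  (T K W : (nat -> A) -> nat -> A) (f g F : nat -> nat -> A) (X Y Z : set (nat -> A)).

Lemma riesz_data X F : X `<=` HA A -> modular_riesz_basis X F -> exists D T E,
  [/\ bounded_op D T, forall i, T (ebasis A i) = F i, 0 < E &
      forall x, HA A x -> hnorm x <= E * hnorm (T x)].
Proof.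
move=> XH [T [[bT [T' [[_ _ [C TC]] T'T _]] _ TF]]].
have [D bD] := bounded_op_of_bounded XH bT; exists D, T, (`|C| + 1); split=> //.
move=> x Hx; have [TX _ _] := bT; have := TC _ (TX _ Hx); rewrite T'T// => h.
have := ler_norm C; have := hnorm_ge0 (T x); nra.
Qed.

Lemma comb_mem X m (c : 'I_m -> A) (u : 'I_m -> nat -> A) (l : seq 'I_m) : X 0 ->
  (forall a x y, X x -> X y -> X (lact a x + y)) -> (forall j, X (u j)) ->
  X (\sum_(j <- l) lact (c j) (u j)).
Proof.
move=> X0 XL Xu; elim: l => [|j l IH]; first by rewrite big_nil.
by rewrite big_cons; exact: XL.
Qed.

Lemma fin_gen_mem X m (u : 'I_m -> nat -> A) :
  X = [set x | exists c : 'I_m -> A, x = \sum_(j < m) lact (c j) (u j)] ->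
  [/\ X 0, forall a x y, X x -> X y -> X (lact a x + y) & forall j, X (u j)].
Proof.
move=> ->; split=> [|a x y [c ->] [c' ->]|j].
- by exists (fun=> 0); rewrite big1// => j _; rewrite lact0.
- exists (fun j => a * c j + c' j).
  have aS : lact a (\sum_(j < m) lact (c j) (u j)) = \sum_(j < m) lact (a * c j) (u j).
    apply: (big_ind2 (fun v w => lact a v = w)); first exact: lactr0.
      by move=> v w v' w' <- <-; rewrite lactDr.
    by move=> j _; rewrite lactA.
  by rewrite aS -big_split /=; apply: eq_bigr => j _; rewrite lactD.
- exists (fun i => if i == j then 1 else 0).
  rewrite (bigD1 j)//= eqxx lact1 big1 ?addr0// => i /negbTE->.
  by rewrite lact0.
Qed.

Lemma fin_gen_hiso X Y : fin_gen X -> hiso X Y -> fin_gen Y.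
Proof.
move=> [m [u XE]] [T [[TY Tl _] [T' [[T'X T'l _] TT' T'T]]]].
have [X0 XL Xu] := fin_gen_mem XE.
have T0 : T 0 = 0.
  have := Tl (-1) _ _ X0 X0; rewrite !lactN1 oppr0 addr0 addNr //.
have TS (c : 'I_m -> A) : T (\sum_(j < m) lact (c j) (u j)) =
    \sum_(j < m) lact (c j) (T (u j)).
  elim: (index_enum 'I_m) => [|j l IH]; first by rewrite !big_nil.
  by rewrite !big_cons Tl// ?IH//; exact: comb_mem.
exists m, (fun j => T (u j)); apply/seteqP; split=> y.
  move=> Yy; have := T'X _ Yy; rewrite {1}XE => -[c e].
  by exists c; rewrite -TS -e T'T.
by move=> [c ->]; rewrite -TS; apply: TY; exact: comb_mem.
Qed.

(** y - T (C_F y) lies in ker C_F, and C_F y in L_d when y is orthogonal to the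
    tail; so the T e_i with i < d are enough additional generators. *)
Lemma fin_gen_shift C D d F T : bessel_by C F -> bounded_op D T ->
  (forall y, HA A y -> analysis F (T y) = y) -> fin_gen (ker_analysis F) ->
  fin_gen (ker_analysis (seq_tail d F)).
Proof.
move=> bF bT FT [m [u NE]]; have bA := bessel_by_analysis bF.
have [N0 NL Nu] := fin_gen_mem NE.
pose w (j : 'I_(m + d)) := match fintype.split j with
  inl i => u i | inr i => T (ebasis A i) end.
exists (m + d)%N, w; apply/seteqP; split=> y.
  move=> [Hy y0]; have Ha := bounded_op_HA bA Hy; have Hs := bounded_op_HA bT Ha.
  have : ker_analysis F (y - T (analysis F y)).
    by split; [exact: HA_B|rewrite (bounded_op_B bA)// FT// subrr].
  rewrite {1}NE => -[c ec].
  exists (fun j => match fintype.split j with inl i => c i | inr i => analysis F y i end).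
  rewrite big_split_ord /= -[y](subrK (T (analysis F y))) {1}ec; congr (_ + _).
    by apply: eq_bigr => i _; rewrite /w (unsplitK (inl i)).
  have tr : analysis F y = trunc d (analysis F y).
    by rewrite truncE -analysis_tail y0 (bounded_op0 (bounded_op_shift A d)) subr0.
  rewrite {1}tr (bounded_op_comb _ _ bT) big_mkord; apply: eq_bigr => i _.
  by rewrite subrK /w (unsplitK (inr i)).
have bF' := bessel_by_tail d bF; have [KH K0 KL _] := closed_ker_analysis bF'.
move=> [c ->]; apply: comb_mem => // j; rewrite /w; case: (fintype.split j) => i.
  have [Hu u0] := Nu i; split=> //; rewrite analysis_tail u0; exact: bounded_op0 (bounded_op_tail A d).
split; first by apply: bounded_op_HA bT _ _; exact: ebasis_HA.
rewrite analysis_tail FT; last exact: ebasis_HA.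
apply/funext => l; rewrite /seq_tail /ebasis gtn_eqF//.
exact: leq_trans (ltn_ord i) (leq_addr _ _).
Qed.

Lemma seq_shift_ebasis d i : seq_shift d (ebasis A i) = ebasis A (d + i).
Proof.
apply/funext => j; rewrite /seq_shift /ebasis; case: ltnP => jd.
  by rewrite ltn_eqF// (leq_trans jd)// leq_addr.
by rewrite -{2}(subnKC jd) eqn_add2l.
Qed.

(** For d large, W is 1 + S sigma^d C_{g,n} with n = k + d and sigma the right
    shift, and W' is its inverse. *)
Lemma perturbation C f g k (M : nat -> R) : bessel_by C f -> 0 < C ->
  (forall n, bessel_by (M n) (seq_tail n g)) -> M @ \oo --> (0 : R) ->
  modular_riesz_basis (Stail f k) (seq_tail k f) ->
  exists d DS S DW W DW' W',
   [/\ modular_riesz_basis (Stail (fun n => f n + g n) (k + d))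
         (seq_tail (k + d) (fun n => f n + g n)),
       bounded_op DS S /\ (forall y, HA A y -> analysis (seq_tail k f) (S y) = y),
       bounded_op DW W /\ bounded_op DW' W',
       (forall y, HA A y -> W (W' y) = y) /\ (forall y, HA A y -> W' (W y) = y) &
       forall y, HA A y -> analysis (seq_tail (k + d) f) (W y) =
         analysis (seq_tail (k + d) (fun n => f n + g n)) y].
Proof.
move=> bf C0 bg M0 rb; have bfk := bessel_by_tail k bf.
have SH : Stail f k `<=` HA A by move=> y [].
have [D [T [E [bT TF E0 below]]]] := riesz_data SH rb.
have [S [DS [bS FS]]] := right_inverse bfk C0 bT TF E0 below.
have DS0 := bounded_op_ge0 bS; pose G := E + DS + 1; have G0 : 0 < G by rewrite /G; lra.
(* With m = sqrt M_n and G > E, DS, this choice gives m E <= 1/2 and m DS < 1: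
   the former keeps the synthesis operator bounded below, the latter makes the
   Neumann series converge. *)
have [d Md] : exists d, M (k + d)%N < (2 * G)^-1 ^+ 2.
  have e0 : 0 < (2 * G)^-1 ^+ 2 by rewrite exprn_gt0 ?invr_gt0 ?mulr_gt0.
  have [N _ H] := (cvgrPdist_lt _ _).1 M0 _ e0; exists N.
  have := H (k + N)%N (leq_addl _ _); rewrite sub0r normrN.
  exact: le_lt_trans (ler_norm _).
have bgn := bg (k + d)%N; have [Mn0 HG _] := bgn.
pose m := Num.sqrt (M (k + d)%N).
have m0 : 0 <= m by exact: sqrtr_ge0.
have mG : m * G <= 2^-1.
  have : m <= (2 * G)^-1.
    rewrite -(@ler_pXn2r _ 2)// ?nnegrE ?invr_ge0 ?mulr_ge0 ?(ltW G0)//.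
    by rewrite sqr_sqrtr// ltW.
  by rewrite -(ler_pM2r G0) => h; apply: le_trans h _; rewrite invfM mulrVK ?unitf_gt0.
have [Gs [bG GE]] := synthesis bgn.
have [_ Hf _] := bf; have Hg n : HA A (g n).
  by have [_ /(_ n)] := bg 0%N.
have bF : bessel_by (2 * C + 2 * M 0%N) (fun n => f n + g n) by apply: bessel_by_add.
have bFn := bessel_by_tail (k + d) bF; have bgn_an := bessel_by_analysis bgn.
exists d, DS, S.
have bK := bounded_op_comp bS (bounded_op_comp (bounded_op_shift A d) bgn_an).
have q1 : DS * (1 * m) < 1.
  by rewrite mul1r; apply: (@le_lt_trans _ _ 2^-1); [rewrite /G in mG; nra|lra].
have [W' [bW' W1 W2]] := neumann bK q1.
have bW := bounded_op_add (bounded_op_id A) bK.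
do 2 eexists; do 2 eexists; split; last 4 first.
- by split; [exact: bS|exact: FS].
- by split; [exact: bW|exact: bW'].
- by split; [exact: W1|exact: W2].
- move=> y Hy; have Ha := bounded_op_HA bgn_an Hy.
  have e1 x : analysis (seq_tail (k + d) f) x = seq_tail d (analysis (seq_tail k f) x).
    by rewrite -analysis_tail seq_tail_add.
  have Hsh := seq_shift_HA (k := d) Ha; have Hs := bounded_op_HA bS Hsh.
  rewrite e1 (bounded_op_D (bessel_by_analysis bfk))// FS// (bounded_op_D (bounded_op_tail A d))//; last first.
    exact: bounded_op_HA (bessel_by_analysis bfk) _ Hy.
  by rewrite tail_shift -e1 -analysis_add// => n; exact: Hf.
have bTF := bounded_op_add (bounded_op_comp bT (bounded_op_shift A d)) bG.
apply: (riesz_of_below bFn bTF (E := 2 * E)).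
- move=> i; rewrite seq_shift_ebasis TF GE /seq_tail addnA //.
- by rewrite mulr_ge0// ltW.
move=> x Hx; have Hsh := seq_shift_HA (k := d) Hx.
have h1 : hnorm x <= E * hnorm (T (seq_shift d x)).
  by rewrite -{1}(_ : hnorm (seq_shift d x) = hnorm x) ?below// /hnorm hinner_shift.
have HTs := bounded_op_HA bT Hsh; have HGx := bounded_op_HA bG Hx.
have h2 := hnormB (HA_D HTs HGx) HGx; rewrite addrK in h2.
have h3 := bounded_op_le bG Hx; rewrite -/m in h3.
set p := hnorm (T (seq_shift d x)) in h1 h2; set q := hnorm (_ + _) in h2 *.
set v := hnorm (Gs x) in h2 h3; set w := hnorm x in h1 h3 *.
have w0 : 0 <= w := hnorm_ge0 x.
have mE : m * E * w <= 2^-1 * w by rewrite ler_wpM2r//; rewrite /G in mG; nra.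
have : E * v <= 2^-1 * w by apply: le_trans mE; have := ltW E0; nra.
have : E * p <= E * (q + v) by rewrite ler_wpM2l// ltW.
lra.
Qed.

End Assembly.

Theorem proposition2p14 (R : realType) (A : cstarAlgType R)
    (g : nat -> nat -> A) (M : nat -> R)
    (g_bessel : bessel g)
    (M_gt0 : forall n, 0 < M n)
    (M_cvg0 : M @ \oo --> (0 : R))
    (g_tail : forall n, bessel_bound (M n) (seq_tail n g)) :
  [/\ forall f : nat -> nat -> A,
        pseudo_riesz_seq f -> pseudo_riesz_seq (fun n => f n + g n),
      forall f : nat -> nat -> A,
        pseudo_riesz_basis f -> pseudo_riesz_basis (fun n => f n + g n),
      forall f : nat -> nat -> A,
        pseudo_riesz_weyl_seq f -> pseudo_riesz_weyl_seq (fun n => f n + g n) &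
      forall f : nat -> nat -> A,
        pseudo_riesz_weyl_basis f ->
        pseudo_riesz_weyl_basis (fun n => f n + g n)].
Proof.
have [Hg _] := g_bessel.
have bg n : bessel_by (M n) (seq_tail n g).
  by apply/bessel_boundP => //; [exact: ltW|move=> i; exact: Hg].
have besF f : bessel f -> bessel (fun n => f n + g n).
  move=> [Hf [C C0 /(bessel_boundP (ltW C0) Hf) bf]].
  exact: bessel_by_bessel (bessel_by_add bf (bg 0%N)).
(* Both Weyl notions provide an isomorphism of L_k onto a closed submodule Z of
   the complement; for a Weyl basis, Z is the whole complement. *)
have core f k : bessel f -> modular_riesz_basis (Stail f k) (seq_tail k f) ->
  exists d, [/\ modular_riesz_basis (Stail (fun n => f n + g n) (k + d))
         (seq_tail (k + d) (fun n => f n + g n)),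
    fin_gen (orth (Stail f k)) -> fin_gen (orth (Stail (fun n => f n + g n) (k + d))) &
    forall Z, closed_submodule Z -> Z `<=` orth (Stail f k) -> hiso (Lsub A k) Z ->
      exists2 Z', [/\ closed_submodule Z', Z' `<=` orth (Stail (fun n => f n + g n) (k + d)) &
        hiso (Lsub A (k + d)) Z'] &
      Z = orth (Stail f k) -> Z' = orth (Stail (fun n => f n + g n) (k + d))].
  move=> [Hf [C C0 /(bessel_boundP (ltW C0) Hf) bf]] rb.
  have [d [DS [S [DW [W [DW' [W' [rF [bS FS] [bW bW'] [W1 W2] WE]]]]]]]] :=
    perturbation bf C0 bg M_cvg0 rb.
  exists d; have bF := bessel_by_add bf (bg 0%N); have [_ HF _] := bF.
  rewrite /Stail !orth_span => [||n]; [|by move=> n; exact: HF|exact: Hf].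
  set F := fun n => f n + g n; set F' := seq_tail (k + d) F.
  have NW : ker_analysis F' = [set y | HA A y /\ ker_analysis (seq_tail (k + d) f) (W y)].
    apply/seteqP; split=> y [Hy].
      by move=> y0; split=> //; split; [exact: bounded_op_HA bW _ Hy|rewrite WE].
    by move=> [_ w0]; split=> //; rewrite -WE.
  have bfk := bessel_by_tail k bf; split=> //.
    rewrite NW -seq_tail_add => fg; apply: fin_gen_hiso (fin_gen_shift d bfk bS FS fg) _.
    apply: hiso_preimage bW bW' W1 W2 _; by move=> y [].
  move=> Z cZ ZN iZ.
  have i1 := hiso_shift d bfk bS FS ZN iZ.
  set Z1 := _ `&` _ in i1.
  have bP := bounded_op_add (bounded_op_id A)
    (bounded_op_opp (bounded_op_comp bS (bessel_by_analysis bfk))).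
  have cZ1 : closed_submodule Z1.
    apply: closed_inter; first exact: closed_ker_analysis (bessel_by_tail d bfk).
    exact: closed_preimage bP cZ.
  have Z1H : Z1 `<=` HA A by move=> y [[]].
  have i2 := hiso_trans i1 (hiso_preimage bW bW' W1 W2 Z1H).
  exists [set y | HA A y /\ Z1 (W y)].
    split=> //; first exact: closed_preimage bW cZ1.
    by rewrite NW -seq_tail_add => y [Hy [Ky _]].
  move=> ZE; rewrite NW -seq_tail_add; apply/seteqP; split=> y [Hy].
    by move=> [].
  move=> Ky; split=> //; split=> //; have Hw := bounded_op_HA bW Hy; split=> //.
  have Ha := bounded_op_HA (bessel_by_analysis bfk) Hw.
  rewrite ZE; split; first exact: bounded_op_HA bP _ Hw.
  by rewrite (bounded_op_B (bessel_by_analysis bfk))// ?FS ?subrr//; exact: bounded_op_HA bS _ Ha.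
have k_gt0 k d : (0 < k)%N -> (0 < k + d)%N by rewrite addn_gt0 => ->.
split=> f [bf [k k0 H]].
- have [d [rF _ _]] := core f k bf H.
  by split; [exact: besF|exists (k + d)%N => //; exact: k_gt0].
- have [rb fg] := H; have [d [rF fF _]] := core f k bf rb.
  by split; [exact: besF|exists (k + d)%N; [exact: k_gt0|split; [|exact: fF]]].
- have [rb [Z [cZ ZN iZ]]] := H; have [d [rF _ wF]] := core f k bf rb.
  have [Z' cZ' _] := wF Z cZ ZN iZ.
  by split; [exact: besF|exists (k + d)%N; [exact: k_gt0|split; [|exists Z']]].
- have [rb iZ] := H; have [d [rF _ wF]] := core f k bf rb.
  split; [exact: besF|exists (k + d)%N; [exact: k_gt0|split=> //]].
  have cN : closed_submodule (orth (Stail f k)).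
    have [Hf [C C0 /(bessel_boundP (ltW C0) Hf) bC]] := bf.
    rewrite /Stail orth_span; last by move=> n; exact: Hf.
    exact: closed_ker_analysis (bessel_by_tail k bC).
  have [Z' [_ _ i] <-//] := wF _ cN (@subset_refl _ _) iZ.
Qed.
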